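(* Let $T>0$, $a>0$, $N\geq 1$ and $2\leq p<3$. If $f\in \mathcal{C}_b^3(\mathbb{R};\mathcal{L}(\mathbb{R}^N,\mathbb{R}))$ and $\mathbb{X}=(\mathbb{X}^1,\mathbb{X}^2)$ is an $N$-dimensional $p$-variation rough path on $[0,T]$, then the reflected rough differential equation $$d y_t = f(y_t)\, d\mathbb{X}_t + d m_t,\qquad y_t\, d m_t=0,$$ admits at most one solution $(y,m)$ on $[0,T]$ with initial condition $a$ (in the sense defined in the context).
   Context: $f\in\mathcal{C}^3_b$ means that $f$ is $3$-times differentiable, bounded with bounded derivatives. Increments. For a path $g$ on $[0,T]$, $\delta g_{st}:=g_t-g_s$; for a two-index map $g$, $\delta g_{sut}:=g_{st}-g_{su}-g_{ut}$. Controls. For an interval $I$ let $\mathcal{S}_I:=\{(s,t)\in I^2: s\leq t\}$. A control on $I$ is a map $\omega:\mathcal{S}_I\to[0,\infty)$ with $\omega(s,u)+\omega(u,t)\leq\omega(s,t)$ for $s\leq u\leq t$. It is regular if $\lim_{|t-s|\to0}\omega(s,t)=0$. Variation spaces. For $q>0$, a Banach space $E$ and $g:\mathcal{S}_I\to E$, set $\|g\|_{\bar V^q_2(I;E)}:=\sup_{(t_i)}\big(\sum_i|g_{t_it_{i+1}}|^q\big)^{1/q}$, the supremum being over all partitions $(t_i)$ of $I$; $\bar V^q_2(I;E)$ is the set of $g$ for which this is finite, and then $\omega_g(s,t):=\|g\|^q_{\bar V^q_2([s,t];E)}$ is a control on $I$. $V^q_2(I;E)$ is the set of $g\in\bar V^q_2(I;E)$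 such that $\omega_g$ is regular. $\bar V^q_1(I;E)$ (resp. $V^q_1(I;E)$) is the set of paths $g:I\to E$ such that $\delta g\in\bar V^q_2(I;E)$ (resp. $V^q_2(I;E)$). $V^q_{2,\mathrm{loc}}(I;E)$ is the set of maps $g:\mathcal{S}_I\to E$ for which there is a countable covering $\{I_k\}_k$ of $I$ by intervals with $g\in V^q_2(I_k;E)$ for every $k$. If $E$ is replaced by a subset of a Banach space, the path is required to take values in that subset. Rough paths. A (continuous) $N$-dimensional $p$-variation rough path on $[0,T]$ is a pair $\mathbb{X}=(\mathbb{X}^1,\mathbb{X}^2)\in V^p_2([0,T];\mathbb{R}^N)\times V^{p/2}_2([0,T];\mathbb{R}^{N\times N})$ such that $\delta\mathbb{X}^{1}_{sut}=0$ and $\delta\mathbb{X}^{2;ij}_{sut}=\mathbb{X}^{1,i}_{su}\mathbb{X}^{1,j}_{ut}$ for all $s<u<t$ in $[0,T]$ and $i,j\in\{1,\dots,N\}$. Solution. Write $f_1,\dots,f_N$ for the components of $f$ and $f_{2,ij}(\xi):=f_i'(\xi)f_j(\xi)$; repeated indices are summed. A pair $(y,m)\in V^p_1([0,T];\mathbb{R}_{\geq0})\times V^1_1([0,T];\mathbb{R}_{\geq0})$ with $m$ increasing (nondecreasing; $m$ is also regarded as a measure with $m([0,t])=m_t$) is a solution on $[0,T]$ with initial condition $a$ if there exists $y^\natural\in V^{p/3}_{2,\mathrm{loc}}([0,T];\mathbb{R})$ such that for all $s\leq t$ in $[0,T]$ $$\delta y_{st}=f_i(y_s)\mathbb{X}^{1,i}_{st}+f_{2,ij}(y_s)\mathbb{X}^{2,ij}_{st}+\delta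 m_{st}+y^\natural_{st},\qquad y_0=a,\qquad m_t=\int_0^t\mathbf{1}_{\{y_u=0\}}\,dm_u .$$
   Formalization: In the solution's equation the second-order term is f_{2,ij}(y_s) X^{2,ji}_{st} instead of f_{2,ij}(y_s) X^{2,ij}_{st}; with the stated Chen relation and f_{2,ij}=f_i'f_j, the printed index order is inconsistent for N≥2 and uniqueness then fails. *)

(* Defs.v *)
From HB Require Import structures.
From mathcomp Require Import all_boot all_order all_algebra.
From mathcomp Require Import all_classical all_reals all_analysis.

Set Implicit Arguments.
Unset Strict Implicit.
Unset Printing Implicit Defensive.

Import Order.TTheory GRing.Theory Num.Theory.
Import numFieldNormedType.Exports.

Local Open Scope classical_set_scope.
Local Open Scope ring_scope.

(* Paths on an interval [I] are total functions [R -> E], and maps on the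
   simplex {(s, t) in I^2 : s <= t} are total functions [R -> R -> E]; only
   their values on [I], resp. on the simplex, are ever used. *)

Section increments.
Context {R : realType} {E : zmodType}.

Definition delta1 (g : R -> E) (s t : R) : E := g t - g s.

Definition delta2 (g : R -> R -> E) (s u t : R) : E := g s t - g s u - g u t.

End increments.

Section variation_spaces.
Context {R : realType} {E : normedModType R}.
Implicit Types (q : R) (I : set R) (g : R -> R -> E).

(* [x] is the list t_1 < ... < t_n = b following t_0 = a, as in
   [itv_partition a b x]. *)
Definition pvar_sum q g (a b : R) (x : seq R) : R :=
  \sum_(i < size x) `|g (nth b (a :: x) i) (nth b (a :: x) i.+1)| `^ q.

(* The interval [I] need not contain its endpoints, so its partitions are the
   finite sequences t_0 < ... < t_n of points of [I].  For [I = [s, t]],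
   requiring in addition t_0 = s and t_n = t does not change the supremum in
   [Vnorm], since adding points at either end only adds nonnegative terms. *)
Definition pvar_sums q I g : set R :=
  [set S | exists a b x,
    [/\ I a, I b, itv_partition a b x & S = pvar_sum q g a b x]].

Definition Vnorm q I g : \bar R :=
  ereal_sup [set (S `^ q^-1)%:E | S in pvar_sums q I g].

Definition Vbar2 q I g : Prop := (Vnorm q I g < +oo)%E.

Definition Vcontrol q g (s t : R) : \bar R := (Vnorm q `[s, t] g `^ q)%E.

Definition regular_control I (omega : R -> R -> \bar R) : Prop :=
  forall e : R, 0 < e -> exists2 d : R, 0 < d &
    forall s t : R, I s -> I t -> s <= t -> t - s < d -> (omega s t < e%:E)%E.

Definition V2 q I g : Prop := Vbar2 q I g /\ regular_control I (Vcontrol q g).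

Definition V1 q I (y : R -> E) : Prop := V2 q I (delta1 y).

Definition V2loc q I g : Prop :=
  exists J : nat -> set R,
    [/\ forall k, is_interval (J k),
        forall k, J k `<=` I,
        I `<=` \bigcup_k J k
      & forall k, V2 q (J k) g].

End variation_spaces.

Section reflected_rde.
Context {R : realType} {N : nat}.

Definition rough_path (T p : R)
    (X1 : R -> R -> 'rV[R]_N) (X2 : R -> R -> 'M[R]_N) : Prop :=
  [/\ V2 p `[0, T] X1,
      V2 (p / 2) `[0, T] X2,
      forall s u t : R, 0 <= s -> s < u -> u < t -> t <= T -> delta2 X1 s u t = 0
    & forall s u t : R, 0 <= s -> s < u -> u < t -> t <= T ->
        forall i j, delta2 X2 s u t i j = X1 s u 0 i * X1 u t 0 j].

(* A linear form on R^N is identified with the row vector of its values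
   [f xi 0 i] on the canonical basis. *)
Definition C3b (f : R -> 'rV[R]_N) : Prop :=
  (forall k, (k < 3)%N -> forall xi, derivable (f^`(k))%classic xi 1) /\
  (forall k, (k <= 3)%N -> bounded_fun (f^`(k))%classic).

Definition coef1 (f : R -> 'rV[R]_N) (i : 'I_N) (xi : R) : R := f xi 0 i.

Definition coef2 (f : R -> 'rV[R]_N) (i j : 'I_N) (xi : R) : R :=
  ((coef1 f i)^`())%classic xi * coef1 f j xi.

(* Index order in the second-order term of [rsol_eq]: in [coef2 f i j] the
   index [j] is that of the increment performed first (f_i(y_u) - f_i(y_s) is
   f_i'(y_s) f_j(y_s) X1_su^j to first order, and it multiplies X1_ut^i),
   whereas [rough_path] puts the first increment in the first index of [X2].
   Hence [coef2 f i j] is paired with [X2 s t j i]: this is the contraction for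
   which delta2 of the first two terms cancels to first order, as a remainder
   of finite p/3-variation requires.

   The measure associated with [m] has mass [m 0] at the point 0, and the
   integrals from 0 to t are over the closed interval [0, t]. *)
Record reflected_solution (T a p : R) (f : R -> 'rV[R]_N)
    (X1 : R -> R -> 'rV[R]_N) (X2 : R -> R -> 'M[R]_N) (y m : R -> R) : Prop :=
  ReflectedSolution {
    rsol_yV : V1 p `[0, T] y;
    rsol_y_ge0 : forall t : R, 0 <= t <= T -> 0 <= y t;
    rsol_mV : V1 1 `[0, T] m;
    rsol_m_ge0 : forall t : R, 0 <= t <= T -> 0 <= m t;
    rsol_m_nd : forall s t : R, 0 <= s -> s <= t -> t <= T -> m s <= m t;
    rsol_eq : exists2 yn : R -> R -> R, V2loc (p / 3) `[0, T] yn &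
      forall s t : R, 0 <= s -> s <= t -> t <= T ->
        delta1 y s t =
          \sum_(i < N) coef1 f i (y s) * X1 s t 0 i
          + \sum_(i < N) \sum_(j < N) coef2 f i j (y s) * X2 s t j i
          + delta1 m s t + yn s t;
    rsol_init : y 0 = a;
    rsol_refl : exists2 mu : {measure set (measurableTypeR R) -> \bar R},
      forall t : R, 0 <= t <= T -> mu `[0%R, t]%classic = (m t)%:E &
      forall t : R, 0 <= t <= T ->
        (m t)%:E =
          (\int[mu]_(u in `[0%R, t]%classic) (\1_[set v | y v = 0%R] u)%:E)%E }.

End reflected_rde.

(* Main.v *)
Require Import Defs.
From HB Require Import structures.
From mathcomp Require Import all_boot all_order all_algebra.
From mathcomp Require Import all_classical all_reals all_analysis.
From mathcomp Require Import lra ring.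
Set Implicit Arguments.
Unset Strict Implicit.
Unset Printing Implicit Defensive.
Import Order.TTheory GRing.Theory Num.Theory.
Import numFieldNormedType.Exports.
Local Open Scope ring_scope.

(** Let [(y, m)] and [(y', m')] be two solutions, and suppose that [y > y'] at
    some time.  Let [s] be the last time before at which [z := y - y']
    vanishes.  Right after [s] one has [y > y' >= 0], so [m] does not move, and
    since [y s = y' s] the rough terms of the two equations started at [s] are
    equal.  Subtracting the equations leaves
        [z u + (m' u - m' s) = gamma s u],
    with [gamma] the difference of the two remainders, and both summands on the
    left are nonnegative.  This sign, available because paths are real valued,
    is what controls the reflection term.  A linear stability estimate
        [|gamma s u| <= M * (Z * w s u ^+ 3 + (m' u - m' s) * w s u)]
    with [Z] the supremum of [z] near [s] and [w] the [p]-th root of a control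
    then gives [z <= Z / 4] on a short interval, hence [Z <= 0], a
    contradiction: this is [comparison].  Exchanging the two solutions gives
    [y = y'], and then [m' - m] is a path whose increments are differences of
    remainders; as sums of remainders along fine partitions tend to 0, this path
    is constant ([reflection_determined]).

    The bounds on remainders rest on [sewing]: a two-parameter map [g] whose
    sums along suitable partitions are arbitrarily small, and whose defect of
    additivity [delta2 g] is small, is itself small.  The bound on [delta2 g]
    is allowed to involve [g] on the left subinterval, which is how remainders
    enter their own defect.  The proof is an induction on the number of points
    of a partition, split at the place where the control has been halved
    ([rc_bisect]), so that no a priori bound on [g] comes in.  It is applied to
    the remainder of one solution ([remainder_bound]) and to [gamma], where the
    defect is controlled by second-order Taylor remainders and increments of
    the coefficients compared at two pairs of points ([remainder_difference],
    [C11_taylor_four_point], [C11_four_point]).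

    By definition the remainder is only locally of finite [p/3]-variation, on
    the members of a countable cover by intervals whose endpoints may
    accumulate.  Only the smallness of partition sums is needed, and that
    property does globalize ([null_on_cover]): creeping from left to right, one
    crosses an endpoint of the [k]-th interval by a tiny step that costs at most
    [e / 2 ^ k], and each interval is charged at most twice.

    The vector structure of the driver disappears early: for fixed [s <= t], the
    two terms of the Davie expansion are real functions of the starting point,
    [a s t] and [b s t], and Chen's relation becomes an identity between them
    ([rough_driver]). *)

(** * Sums along partitions *)

Section partition_sums.
Context {R : realType}.
Implicit Types (a b c s t : R) (x : seq R) (h : R -> R -> R).

Fixpoint psum h a x : R :=
  if x is b :: x' then h a b + psum h b x' else 0.

Lemma psum_cat h a x x' : psum h a (x ++ x') = psum h a x + psum h (last a x) x'.
Proof. by elim: x a => [|b x IH] a /=; rewrite ?add0r // IH addrA. Qed.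

Lemma path_lt_last a x : path <%R a x -> a <= last a x.
Proof.
elim: x a => [|b x IH] a //= /andP[ab /IH]; exact/le_trans/ltW.
Qed.

Lemma path_lt_split a x c x' : path <%R a (x ++ c :: x') ->
  [/\ path <%R a x, last a x < c & path <%R c x'].
Proof. by rewrite cat_path /= => /and3P[]. Qed.

Lemma le_psum (e : rel R) h k a x s t : subrel e <%R -> path e a x ->
  s <= a -> last a x <= t ->
  (forall b c, s <= b -> e b c -> c <= t -> h b c <= k b c) ->
  psum h a x <= psum k a x.
Proof.
move=> elt + + + hk; elim: x a => [|b x IH] a //= /andP[ab bx] sa xt.
have bl := path_lt_last (sub_path elt bx); have ab' := elt _ _ ab.
apply: lerD; first by apply: hk => //; apply: le_trans xt.
by apply: IH => //; apply: le_trans sa (ltW ab').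
Qed.

Lemma psum_ge0 h a x : path <%R a x ->
  (forall b c, a <= b -> b < c -> c <= last a x -> 0 <= h b c) ->
  0 <= psum h a x.
Proof.
move=> ax h0; have: psum (fun _ _ => 0) a x <= psum h a x.
  by apply: (le_psum _ ax (lexx _) (lexx _)) => // b c ab bc cx; apply: h0.
suff -> : psum (fun _ _ => 0) a x = 0 by [].
by elim: x a {ax h0} => //= b x IH a; rewrite IH addr0.
Qed.

Lemma psumM k h a x : psum (fun b c => k * h b c) a x = k * psum h a x.
Proof. by elim: x a => [|b x IH] a /=; rewrite ?mulr0 // IH mulrDr. Qed.

Lemma psum_telescope (u : R -> R) a x :
  psum (fun b c => u c - u b) a x = u (last a x) - u a.
Proof. elim: x a => [|b x IH] a /=; rewrite ?subrr // IH; ring. Qed.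

Definition superadditive (T : R) (om : R -> R -> R) : Prop :=
  forall s u t, 0 <= s -> s <= u -> u <= t -> t <= T ->
    om s u + om u t <= om s t.

Lemma psum_superadditive T om a x : superadditive T om ->
  (forall t, 0 <= t -> t <= T -> 0 <= om t t) ->
  0 <= a -> path <%R a x -> last a x <= T -> psum om a x <= om a (last a x).
Proof.
move=> omS om0; elim: x a => [|b x IH] a a0 /=; first by move=> _ aT; apply: om0.
move=> /andP[ab bx] xT; have bl := path_lt_last bx.
apply: le_trans (omS _ _ _ a0 (ltW ab) bl xT).
by rewrite lerD2l; apply: IH => //; apply: le_trans a0 (ltW ab).
Qed.

(** The partition may depend on [e] and need not be fine.  This weak form is
    stable under concatenation, and it is all that [sewing] asks for. *)
Definition null_on h s t : Prop := forall e, 0 < e ->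
  exists x, [/\ path <%R s x, last s x = t & psum h s x <= e].

Lemma fine_partition s t d : s <= t -> 0 < d ->
  exists x, path (fun b c => (b < c) && (c - b < d)) s x /\ last s x = t.
Proof.
move=> st d0; have d20 : 0 < d / 2 by lra.
have [n] : exists n, t - s < n%:R * (d / 2).
  exists (Num.truncn ((t - s) / (d / 2))).+1.
  by rewrite -ltr_pdivrMr// truncnS_gt.
elim: n s st => [|n IH] s st; first by rewrite mul0r; lra.
rewrite -natr1 mulrDl mul1r => tsn.
have [tsd|tsd] := ltP (t - s) d.
  move: st; rewrite le_eqVlt => /predU1P[->|st]; first by exists [::].
  by exists [:: t]; rewrite /= st tsd.
have [|//|x [sx xt]] := IH (s + d / 2); [lra|lra|].
by exists (s + d / 2 :: x) => /=; split=> //; rewrite sx andbT; lra.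
Qed.

(** For an exponent [q < 1], a sum of [h] is at most the sum of [h `^ q] times the
    largest value of [h `^ (1 - q)], which is small along fine partitions. *)
Lemma null_on_pvar h q M s t : 0 < q -> q < 1 -> s <= t ->
  (forall b c, s <= b -> b < c -> c <= t -> 0 <= h b c) ->
  (forall x, path <%R s x -> last s x = t ->
     psum (fun b c => h b c `^ q) s x <= M) ->
  (forall e, 0 < e -> exists2 d, 0 < d & forall b c, s <= b -> b < c ->
     c <= t -> c - b < d -> h b c < e) ->
  null_on h s t.
Proof.
move=> q0 q1 st h0 hM hreg e e0.
have M10 : 0 < `|M| + 1 by have := normr_ge0 M; lra.
have q1' : 0 < 1 - q by lra.
(* so that [e1 `^ (1 - q) * `|M| <= e] *)
pose e1 := (e / (`|M| + 1)) `^ (1 - q)^-1.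
have e10 : 0 < e1 by rewrite powR_gt0// divr_gt0.
have [d d0 hd] := hreg _ e10.
have [x [sx xt]] := fine_partition st d0.
have sx' : path <%R s x by apply: sub_path sx => b c /andP[].
exists x; split=> //.
have : psum h s x <= psum (fun b c => e1 `^ (1 - q) * h b c `^ q) s x.
  apply: (le_psum _ sx (lexx _)) => [b c /andP[]//||b c sb /andP[bc bcd] ct].
    by rewrite xt.
  have hbc := h0 _ _ sb bc ct.
  rewrite -[leLHS](powRr1 hbc) -[X in _ `^ X](subrK q) powRD; last first.
    by rewrite subrK oner_eq0.
  rewrite ler_wpM2r ?powR_ge0//; apply: ge0_ler_powR; rewrite ?nnegrE//.
  - exact: ltW.
  - exact: ltW.
  - exact/ltW/hd.
rewrite psumM => /le_trans; apply.
rewrite /e1 -powRrM mulVf ?gt_eqF// powRr1; last by rewrite divr_ge0 ?ltW.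
have := hM _ sx' xt; have := ler_norm M => ? ?.
rewrite mulrAC ler_pdivrMr// ler_pM2l//; lra.
Qed.

End partition_sums.

(** * A discrete sewing lemma *)

Section sewing.
Context {R : realType}.
Implicit Types (a b c s t : R) (x : seq R) (w g : R -> R -> R).

(** The [p]-th root [w] of a control, normalized by [w <= 1].  With [w] rather
    than the control as basic object, all estimates below are polynomial. *)
Record root_control (T p : R) w : Prop := RootControl {
  rc_ge0 : forall s t, 0 <= s -> s <= t -> t <= T -> 0 <= w s t;
  rc_le1 : forall s t, 0 <= s -> s <= t -> t <= T -> w s t <= 1;
  rc_super : superadditive T (fun s t => w s t `^ p);
  rc_small : forall e, 0 < e -> exists2 d, 0 < d &
    forall s t, 0 <= s -> s <= t -> t <= T -> t - s < d -> w s t < e }.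

Lemma ler_powR_inv (p u v : R) : 0 < p -> 0 <= u -> 0 <= v ->
  u `^ p <= v `^ p -> u <= v.
Proof.
move=> p0 u0 v0; apply: contraTT; rewrite -!ltNge => vu.
by apply: gt0_ltr_powR; rewrite ?nnegrE.
Qed.

Lemma powR_lt1 (q u : R) : 0 < q -> 0 <= u -> u < 1 -> u `^ q < 1.
Proof.
move=> q0 u0 u1; have := gt0_ltr_powR q0 (x := u) (y := 1).
by rewrite powR1; apply; rewrite ?nnegrE.
Qed.

Variables (T p : R) (w : R -> R -> R).
Hypotheses (p0 : 0 < p) (rc : root_control T p w).

Lemma rc_mono s s' t' t : 0 <= s -> s <= s' -> s' <= t' -> t' <= t -> t <= T ->
  w s' t' <= w s t.
Proof.
move=> s0 ss st tt tT.
have s'0 : 0 <= s' by lra.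
have t'T : t' <= T by lra.
have s't : s' <= t by lra.
apply: (ler_powR_inv p0); [by apply: (rc_ge0 rc)|by apply: (rc_ge0 rc)=> //; lra|].
have := rc_super rc s0 ss s't tT; have := rc_super rc s'0 st tt tT => /=.
have := powR_ge0 (w s s') p; have := powR_ge0 (w t' t) p; lra.
Qed.

Lemma rc_diag s : 0 <= s -> s <= T -> w s s = 0.
Proof.
move=> s0 sT; have := rc_super rc s0 (lexx _) (lexx _) sT => /= h.
have : w s s `^ p = 0 by have := powR_ge0 (w s s) p; lra.
by move=> /powR_eq0_eq0.
Qed.

(** The factor by which [w] shrinks when the control [w `^ q] is halved. *)
Definition half_root (q : R) : R := 2^-1 `^ q^-1.

Lemma half_root_ge0 : 0 <= half_root p. Proof. exact: powR_ge0. Qed.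

Lemma half_root_lt1 : half_root p < 1.
Proof.
by apply: powR_lt1; rewrite ?invr_gt0//; lra.
Qed.

Lemma half_root_pow : half_root p `^ p = 2^-1.
Proof. by rewrite /half_root -powRrM mulVf ?gt_eqF// powRr1// invr_ge0. Qed.

(** This is where [p < 3] enters: cutting an interval in two halves of equal
    control decreases the sum of the [w ^+ 3] by a constant factor. *)
Lemma half_root_cube : p < 3 -> 2 * half_root p ^+ 3 < 1.
Proof.
move=> p3; rewrite -powR_mulrn ?half_root_ge0//.
have -> : 3%:R = p + (3 - p) :> R by ring.
rewrite powRD; last by rewrite addrC subrK pnatr_eq0.
rewrite half_root_pow mulrA divff// mul1r.
by apply: powR_lt1 half_root_ge0 half_root_lt1; rewrite subr_gt0.
Qed.

(** The mesh interval from [last a x1] to [c] is the one in which the control,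
    accumulated from [a], passes half of its total; by superadditivity at most
    half of it is left after [c]. *)
Lemma rc_bisect a x : 0 <= a -> path <%R a x -> last a x <= T -> x != [::] ->
  exists x1 c x2, [/\ x = x1 ++ c :: x2,
    w a (last a x1) <= half_root p * w a (last a x)
    & w c (last c x2) <= half_root p * w a (last a x)].
Proof.
move=> a0 ax xT xn0; set b := last a x in xT *.
have ab : a <= b := path_lt_last ax.
have w0 := rc_ge0 rc a0 ab xT.
have aT : a <= T by apply: le_trans xT.
pose P c := w a b `^ p / 2 <= w a c `^ p.
have hx : has P x.
  apply/hasP; exists b; last by rewrite /P; have := powR_ge0 (w a b) p; lra.
  by rewrite /b; case: (x) xn0 => //= y z _; rewrite mem_last.
have key c d : 0 <= c -> c <= d -> d <= T -> w c d `^ p <= w a b `^ p / 2 ->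
    w c d <= half_root p * w a b.
  move=> c0 cd dT h; have := half_root_ge0 => hr.
  apply: (ler_powR_inv p0); [exact: (rc_ge0 rc)|by rewrite mulr_ge0|].
  by rewrite powRM// half_root_pow mulrC.
have [x1 [c [x2 [xE Pc nP]]]] :
    exists x1 c x2, [/\ x = x1 ++ c :: x2, P c & ~~ has P x1].
  clearbody P; case: (split_find hx) => c x1 x2 Pc nP.
  by exists x1, c, x2; rewrite cat_rcons.
move: (ax); rewrite xE => /path_lt_split[ax1 x1c cx2].
have ax1' := path_lt_last ax1; have cx2' := path_lt_last cx2.
have bE : b = last c x2 by rewrite /b xE last_cat.
rewrite -bE in cx2'.
exists x1, c, x2; split; rewrite -?bE //; apply: key => //; try lra.
- case/lastP: x1 nP {xE ax1 x1c ax1'} => [|x1 u] nP /=.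
    rewrite rc_diag// powR0 ?gt_eqF// divr_ge0// powR_ge0//.
  move: nP; rewrite has_rcons negb_or last_rcons => /andP[+ _].
  by rewrite /P -ltNge => /ltW.
- have ac : a <= c by lra.
  have := rc_super rc a0 ac cx2' xT; move: Pc; rewrite /P /=; lra.
Qed.

(** The induction step of [sewing].  The two outer intervals carry [g1], [g2],
    the mesh interval between them carries [gc], and [d1], [d2] are the two
    defects.  The factor [th < 1] gained on the outer intervals leaves room for
    the defects, provided that [W] is small compared with [C]. *)
Lemma sewing_step (C K lam th eta Z W k k1 k2 w1 w2 e1 e2 gc g1 g2 d1 d2 G : R) :
  0 <= C -> 0 <= K -> 0 <= lam -> lam <= th -> 2 * lam ^+ 3 <= th -> th <= 1 ->
  2 * C + C * eta * K <= K * (1 - th) ->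
  0 <= Z -> 0 <= k1 -> 0 <= k2 -> k1 + k2 <= k -> 0 <= e1 -> 0 <= e2 -> 0 <= gc ->
  0 <= w1 -> w1 <= lam * W -> 0 <= w2 -> w2 <= lam * W -> 0 <= W -> W <= eta ->
  g1 <= e1 + K * (Z * w1 ^+ 3 + (k1 + e1) * w1) ->
  g2 <= e2 + K * (Z * w2 ^+ 3 + (k2 + e2) * w2) ->
  d1 <= C * (Z * W ^+ 3 + k * W + g1 * W) ->
  d2 <= C * (Z * W ^+ 3 + k * W + gc * W) ->
  G <= g1 + gc + g2 + d1 + d2 ->
  G <= e1 + (gc + e2) + K * (Z * W ^+ 3 + (k + (e1 + (gc + e2))) * W).
Proof.
move=> C0 K0 lam0 lamth lam3th th1 CK Z0 k10 k20 k12 e10 e20 gc0.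
move=> w10 w1l w20 w2l W0 Weta H1 H2 D1 D2 tri.
set e := e1 + (gc + e2); have e0 : 0 <= e by rewrite /e !addr_ge0.
have k0 : 0 <= k by apply: le_trans k12; apply: addr_ge0.
set B := Z * W ^+ 3 + (k + e) * W.
have W30 : 0 <= W ^+ 3 by rewrite exprn_ge0.
have ZW0 : 0 <= Z * W ^+ 3 by rewrite mulr_ge0.
have B0 : 0 <= B by rewrite addr_ge0// mulr_ge0// addr_ge0.
have part v h : 0 <= v -> v <= lam * W -> 0 <= h ->
    Z * v ^+ 3 + h * v <= lam ^+ 3 * (Z * W ^+ 3) + lam * (h * W).
  move=> v0 vl h0; rewrite [lam ^+ 3 * _]mulrCA [lam * (h * _)]mulrCA.
  apply: lerD; apply: ler_wpM2l => //.
  by rewrite -exprMn lerXn2r ?nnegrE// mulr_ge0.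
have B12 : Z * w1 ^+ 3 + (k1 + e1) * w1 + (Z * w2 ^+ 3 + (k2 + e2) * w2)
    <= th * B.
  have h1 := part _ _ w10 w1l (addr_ge0 k10 e10).
  have h2 := part _ _ w20 w2l (addr_ge0 k20 e20).
  have h3 : 2 * lam ^+ 3 * (Z * W ^+ 3) <= th * (Z * W ^+ 3).
    exact: ler_wpM2r.
  have h4 : ((k1 + e1) + (k2 + e2)) * W <= (k + e) * W.
    by apply: ler_wpM2r => //; rewrite /e; clear -k12 gc0; lra.
  have h5 := ler_wpM2l lam0 h4.
  have h6 : lam * ((k + e) * W) <= th * ((k + e) * W).
    by apply: ler_wpM2r => //; rewrite mulr_ge0// addr_ge0.
  rewrite /B; clear -h1 h2 h3 h5 h6; lra.
have B1 : Z * w1 ^+ 3 + (k1 + e1) * w1 <= B.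
  have h1 : 0 <= Z * w2 ^+ 3 + (k2 + e2) * w2.
    by rewrite addr_ge0// mulr_ge0// ?exprn_ge0// addr_ge0.
  have h2 : th * B <= B by rewrite ler_piMl.
  clear -h1 h2 B12; lra.
have gW : g1 * W <= e1 * W + K * (eta * B).
  have h1 : g1 * W <= (e1 + K * B) * W.
    apply: ler_wpM2r => //; apply: le_trans H1 _.
    by rewrite lerD2l; apply: ler_wpM2l.
  have h2 : K * (B * W) <= K * (eta * B).
    by apply: ler_wpM2l => //; rewrite mulrC; apply: ler_wpM2r.
  clear -h1 h2; lra.
have eW : 0 <= gc * W /\ 0 <= e2 * W /\ 0 <= e1 * W by rewrite !mulr_ge0.
have D1' : d1 <= C * (B + K * (eta * B)).
  apply: le_trans D1 _; apply: ler_wpM2l => //.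
  have h : Z * W ^+ 3 + k * W + e1 * W <= B by rewrite /B /e; clear -eW; lra.
  clearbody B; clear -h gW; lra.
have D2' : d2 <= C * B.
  apply: le_trans D2 _; apply: ler_wpM2l => //.
  rewrite /B /e; clear -eW; lra.
have KB := ler_wpM2l K0 B12.
have CB := ler_wpM2r B0 CK.
clearbody B; rewrite /e; clear -KB CB D1' D2' H1 H2 tri; lra.
Qed.

(** The hypothesis on [delta2 g] mentions [g a u] itself.  In the induction this
    value is bounded by the induction hypothesis, and the additional factor [w]
    absorbs it once [w s t <= eta].  The errors made on the intervals of the
    partition add up to the partition sum [e], which is carried along as part of
    the superadditive map [kap] and tends to 0 at the end. *)
Theorem sewing (C : R) : 0 <= C -> p < 3 ->
  exists eta K, [/\ 0 < eta, 0 <= K &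
    forall g (kap : R -> R -> R) (Z s t : R), 0 <= s -> s <= t -> t <= T ->
      w s t <= eta -> 0 <= Z ->
      (forall a b, s <= a -> a <= b -> b <= t -> 0 <= kap a b) ->
      (forall a u b, s <= a -> a <= u -> u <= b -> b <= t ->
         kap a u + kap u b <= kap a b) ->
      (forall a, s <= a -> a <= t -> g a a = 0) ->
      (forall a u b, s <= a -> a <= u -> u <= b -> b <= t ->
        `|delta2 g a u b| <=
          C * (Z * w a b ^+ 3 + kap a b * w a b + `|g a u| * w a b)) ->
      null_on (fun a b => `|g a b|) s t ->
      `|g s t| <= K * (Z * w s t ^+ 3 + kap s t * w s t)].
Proof.
move=> C0 p3; set lam := half_root p.
have lam0 : 0 <= lam := half_root_ge0.
pose th := Num.max (2 * lam ^+ 3) lam.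
have th1 : th < 1 by rewrite /th gt_max half_root_cube// half_root_lt1.
have lamth : lam <= th by rewrite /th le_max lexx orbT.
have lam3th : 2 * lam ^+ 3 <= th by rewrite /th le_max lexx.
have th0 : 0 <= th by lra.
have C10 : 0 < 2 * (C + 1) by lra.
have th10 : 0 < 1 - th by lra.
exists ((1 - th) / (2 * (C + 1))), (4 * C / (1 - th)).
set eta := _ / (2 * _); set K := _ / (1 - th).
have eta0 : 0 < eta by rewrite divr_gt0.
have K0 : 0 <= K by rewrite divr_ge0 ?mulr_ge0// ltW.
split=> // g kap Z s t s0 st tT wst Z0 kap0 kapS g0 dg gnull.
have CK : 2 * C + C * eta * K <= K * (1 - th).
  have -> : K * (1 - th) = 4 * C by rewrite /K divfK// gt_eqF.
  suff : C * eta * K <= 2 * C by lra.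
  rewrite /eta /K.
  have -> : C * ((1 - th) / (2 * (C + 1))) * (4 * C / (1 - th)) =
    (2 * C) * (C / (C + 1)) by field; rewrite !gt_eqF//; lra.
  rewrite ler_piMr ?mulr_ge0// ler_pdivrMr; lra.
have main n x a : (size x < n)%N -> s <= a -> path <%R a x -> last a x <= t ->
    let e := psum (fun a b => `|g a b|) a x in
    let b := last a x in
    `|g a b| <= e + K * (Z * w a b ^+ 3 + (kap a b + e) * w a b).
  elim: n x a => // n IH x a xn sa ax xt.
  have ab := path_lt_last ax.
  have [x0|xn0] := eqVneq x [::].
    rewrite x0 /= in ab xt *; rewrite g0// normr0 rc_diag//.
    - by rewrite expr0n /= !mulr0 !addr0 mulr0.
    - exact: le_trans sa.
    - exact: le_trans xt tT.
  have a0 : 0 <= a := le_trans s0 sa.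
  have xT : last a x <= T := le_trans xt tT.
  have [x1 [c [x2 [xE]]]] := rc_bisect a0 ax xT xn0.
  move: xn ax xt ab xT; rewrite xE size_cat /= addnS ltnS => xn.
  rewrite last_cat psum_cat /=; set u := last a x1; set b := last c x2.
  move=> /path_lt_split[ax1 uc cx2] bt ab bT.
  have au : a <= u := path_lt_last ax1; have cb : c <= b := path_lt_last cx2.
  rewrite -/u -/b => w1 w2.
  have sx1 : (size x1 < n)%N by rewrite (leq_trans _ xn)// ltnS leq_addr.
  have sx2 : (size x2 < n)%N by rewrite (leq_trans _ xn)// ltnS leq_addl.
  have := IH x1 a sx1 sa ax1; have := IH x2 c sx2; rewrite -/u -/b /=.
  set e1 := psum _ a x1; set e2 := psum _ c x2.
  have e10 : 0 <= e1 by apply: psum_ge0.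
  have e20 : 0 <= e2 by apply: psum_ge0.
  have {}uc : u < c := uc.
  have uc' := ltW uc.
  have su : s <= u := le_trans sa au.
  have sc : s <= c := le_trans su uc'.
  have ct : c <= t := le_trans cb bt.
  have ut : u <= t := le_trans uc' ct.
  have ub : u <= b := le_trans uc' cb.
  have [u0 c0] : 0 <= u /\ 0 <= c by split; apply: le_trans s0 _.
  move=> /(_ sc cx2 bt) H2 /(_ ut) H1.
  have D1 := dg a u b sa au ub bt.
  have D2 := dg u c b su uc' cb bt.
  have k12 := kapS a u b sa au ub bt.
  have k23 := kapS u c b su uc' cb bt.
  have k1 := kap0 a u sa au ut.
  have k2 := kap0 u c su uc' ct.
  have k3 := kap0 c b sc cb bt.
  have k4 := kap0 u b su ub bt.
  have wau0 := rc_ge0 rc a0 au (le_trans ut tT).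
  have wcb0 := rc_ge0 rc c0 cb bT.
  have wub0 := rc_ge0 rc u0 ub bT.
  have W0 := rc_ge0 rc a0 ab bT.
  have wub : w u b <= w a b by apply: rc_mono.
  have Weta : w a b <= eta by apply: le_trans wst; apply: rc_mono.
  have guc0 := normr_ge0 (g u c).
  have gau0 := normr_ge0 (g a u).
  have tri : `|g a b| <= `|g a u| + `|g u c| + `|g c b| +
      `|delta2 g a u b| + `|delta2 g u c b|.
    have -> : g a b = g a u + g u c + g c b + delta2 g a u b + delta2 g u c b.
      by rewrite /delta2; ring.
    do 3 (apply: le_trans (ler_normD _ _) _; rewrite lerD2r).
    exact: ler_normD.
  have := sewing_step C0 K0 lam0 lamth lam3th (ltW th1) CK Z0 k1 k3 _ e10 e20 guc0
     wau0 w1 wcb0 w2 W0 Weta H1 H2 D1.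
  apply; [by clear -k12 k23 k2; lra| |exact: tri].
  apply: le_trans D2 _; apply: ler_wpM2l => //.
  apply: lerD; last exact: ler_wpM2l.
  apply: lerD; last by apply: ler_pM => //; clear -k12 k1; lra.
  by apply: ler_wpM2l => //; rewrite lerXn2r ?nnegrE.
have K1 : 0 < K * w s t + 1.
  by rewrite ltr_wpDl// mulr_ge0// (rc_ge0 rc).
apply/ler_addgt0Pr => e e0.
have [x [sx xt xe]] := gnull (e / (K * w s t + 1)) ltac:(exact: divr_gt0).
have := main (size x).+1 x s (ltnSn _) (lexx _) sx; rewrite /= xt => /(_ (lexx _)).
move: xe; rewrite ler_pdivlMr//; set E := psum _ _ _ => xe h.
apply: le_trans h _; clear -xe; lra.
Qed.
End sewing.

(** * Taylor estimates for one and for two pairs of points *)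

Section one_variable_calculus.
Context {R : realType}.
Implicit Types (f df ddf g dg : R -> R) (K Z a b x y : R).

Lemma MVT01 f df : (forall x, is_derive x 1 f (df x)) ->
  exists r, [/\ 0 <= r, r <= 1 & f 1 - f 0 = df r].
Proof.
move=> dfE.
have [|r r01] := @MVT_segment R f df 0 1 ler01 (fun x _ => dfE x).
  by apply: derivable_within_continuous => x _; have [] := dfE x.
rewrite subr0 mulr1 => fE; exists r; move: r01.
by rewrite in_itv /= => /andP[].
Qed.

(** One constant for the function, its derivative and the Lipschitz constant of
    the derivative: below it is a multiple of a power of [w s t]. *)
Record C11 K f df : Prop := {
  C11_derive : forall x, is_derive x 1 f (df x);
  C11_bound : forall x, `|f x| <= K;
  C11_dbound : forall x, `|df x| <= K;
  C11_dlip : forall x y, `|df x - df y| <= K * `|x - y| }.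

(** The same [r] serves both segments: the mean value theorem is applied to the
    difference of [f] and [g] along the two segments run at the same time. *)
Lemma MVT_two_segments f df g dg a b a' b' :
  (forall x, is_derive x 1 f (df x)) -> (forall x, is_derive x 1 g (dg x)) ->
  exists r, [/\ 0 <= r, r <= 1 &
    (f b - f a) - (g b' - g a') =
      df (a + r * (b - a)) * (b - a) - dg (a' + r * (b' - a')) * (b' - a')].
Proof.
move=> dfE dgE.
have along (h dh : R -> R) c d r : (forall x, is_derive x 1 h (dh x)) ->
    is_derive (r : R) (1 : R) (fun r : R => h (c + r * (d - c)))
      (dh (c + r * (d - c)) * (d - c)).
  move=> dhE; have lE : is_derive (r : R) (1 : R) (fun r : R => c + r * (d - c)) (d - c).
    by apply: is_derive_eq; rewrite /GRing.scale/=; ring.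
  exact: (is_derive1_comp (dhE _) lE).
have [r [r0 r1 rE]] := MVT01 (fun r => is_deriveB (along f df a b r dfE)
  (along g dg a' b' r dgE)).
have {}rE : f (a + 1 * (b - a)) - g (a' + 1 * (b' - a')) -
    (f (a + 0 * (b - a)) - g (a' + 0 * (b' - a'))) =
    df (a + r * (b - a)) * (b - a) - dg (a' + r * (b' - a')) * (b' - a') := rE.
exists r; split=> //; rewrite -rE !mul1r !mul0r !addr0.
by rewrite [a + _]addrC [a' + _]addrC !subrK; ring.
Qed.

Lemma MVT_line f df a b : (forall x, is_derive x 1 f (df x)) ->
  exists r, [/\ 0 <= r, r <= 1 & f b - f a = df (a + r * (b - a)) * (b - a)].
Proof.
move=> dfE; have [r [r0 r1]] := MVT_two_segments a b 0 0 dfE (is_derive_cst (0 : R) ^~ 1).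
by rewrite !subrr mulr0 !subr0 => rE; exists r.
Qed.

Lemma C11_lip K f df x y : C11 K f df -> `|f x - f y| <= K * `|x - y|.
Proof.
move=> [dfE _ dfK _]; have [r [_ _ ->]] := MVT_line y x dfE.
by rewrite normrM ler_wpM2r.
Qed.

(** Subtracting the tangent slope [df a] from [f] turns a first-order Taylor
    remainder into an increment, to which the mean value theorem applies. *)
Lemma is_derive_tangent f df a x : (forall x, is_derive x 1 f (df x)) ->
  is_derive x 1 (fun x => f x - df a * x) (df x - df a).
Proof.
move=> dfE; have := dfE x => ?.
by apply: is_derive_eq; rewrite /GRing.scale/=; ring.
Qed.

Lemma convex_le Z a a' b b' r : 0 <= r -> r <= 1 ->
  `|a - a'| <= Z -> `|b - b'| <= Z ->
  `|a + r * (b - a) - (a' + r * (b' - a'))| <= Z.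
Proof.
move=> r0 r1 aZ bZ.
have -> : a + r * (b - a) - (a' + r * (b' - a')) = (1 - r) * (a - a') + r * (b - b').
  by ring.
have r1' : 0 <= 1 - r by rewrite subr_ge0.
apply: le_trans (ler_normD _ _) _; rewrite !normrM !(ger0_norm r0) !(ger0_norm r1').
have := ler_wpM2l r0 bZ; have := ler_wpM2l r1' aZ; clear; lra.
Qed.

Lemma C11_ge0 K f df : C11 K f df -> 0 <= K.
Proof. by move=> Hf; apply: le_trans (normr_ge0 _) (C11_bound Hf 0). Qed.

Lemma C11_taylor K f df a b : C11 K f df ->
  `|f b - f a - df a * (b - a)| <= K * `|b - a| ^+ 2.
Proof.
move=> Hf; have K0 := C11_ge0 Hf.
have [r [r0 r1]] := MVT_line a b (is_derive_tangent a ^~ (C11_derive Hf)).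
have -> : f b - df a * b - (f a - df a * a) = f b - f a - df a * (b - a) by ring.
move=> ->; rewrite normrM expr2 mulrA ler_wpM2r//.
apply: le_trans (C11_dlip Hf _ _) _; rewrite ler_wpM2l//.
by rewrite addrC addKr normrM ger0_norm// ler_piMl.
Qed.

(** Linear in the distance [Z] of the two pairs of points and in the difference of
    the two increments, as needed for stability estimates. *)
Lemma C11_four_point K f df Z a b a' b' : C11 K f df ->
  `|a - a'| <= Z -> `|b - b'| <= Z ->
  `|(f b - f a) - (f b' - f a')| <=
    K * (Z * `|b - a| + `|(b - a) - (b' - a')|).
Proof.
move=> Hf aZ bZ; have K0 := C11_ge0 Hf.
have [r [r0 r1 ->]] :=
  MVT_two_segments a b a' b' (C11_derive Hf) (C11_derive Hf).
set u := a + _; set v := a' + _.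
have -> : df u * (b - a) - df v * (b' - a') =
  (df u - df v) * (b - a) + df v * ((b - a) - (b' - a')) by ring.
apply: le_trans (ler_normD _ _) _; rewrite !normrM mulrDr mulrA.
apply: lerD; apply: ler_wpM2r => //; last exact: C11_dbound Hf _.
by apply: le_trans (C11_dlip Hf _ _) _; rewrite ler_wpM2l// convex_le.
Qed.

Lemma C11_taylor_four_point K f df ddf Z a b a' b' : C11 K f df -> C11 K df ddf ->
  `|a - a'| <= Z -> `|b - b'| <= Z ->
  `|(f b - f a - df a * (b - a)) - (f b' - f a' - df a' * (b' - a'))| <=
    K * (Z * `|b - a| + `|(b - a) - (b' - a')|) * `|b - a| +
    K * `|b' - a'| * `|(b - a) - (b' - a')|.
Proof.
move=> Hf Hdf aZ bZ; have K0 := C11_ge0 Hf.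
have dfE := C11_derive Hf.
have [r [r0 r1]] := MVT_two_segments a b a' b'
  (is_derive_tangent a ^~ dfE) (is_derive_tangent a' ^~ dfE).
set u := a + _; set v := a' + _ => h.
have -> : f b - f a - df a * (b - a) - (f b' - f a' - df a' * (b' - a')) =
  ((df u - df a) - (df v - df a')) * (b - a) +
  (df v - df a') * ((b - a) - (b' - a')) by move: h; lra.
have ua : u - a = r * (b - a) by rewrite /u; ring.
have va : v - a' = r * (b' - a') by rewrite /v; ring.
have rle y : `|r * y| <= `|y| by rewrite normrM ger0_norm// ler_piMl.
apply: le_trans (ler_normD _ _) _; rewrite !normrM.
apply: lerD; apply: ler_wpM2r => //.
  apply: le_trans (C11_four_point Hdf aZ (convex_le r0 r1 aZ bZ)) _.
  rewrite ler_wpM2l// ua va -mulrBr lerD// ler_wpM2l//.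
  exact: le_trans (normr_ge0 _) aZ.
apply: le_trans (C11_dlip Hf _ _) _; rewrite ler_wpM2l// va; exact: rle.
Qed.

End one_variable_calculus.

(** * Remainders of Davie expansions *)

Section remainders.
Context {R : realType}.
Implicit Types (T p C K L Z s t u r : R) (w : R -> R -> R) (a da dda b db : R -> R -> R -> R) (y m : R -> R).

(** [a s t x] stands for [\sum_i f_i(x) X1_st^i] and [b s t x] for
    [\sum_ij f_i'(x) f_j(x) X2_st^ji]; [da], [dda] and [db] are derivatives in
    [x].  In this form Chen's relation says that the increment of [a] over
    [[s, u]] acts on [a u t] through its derivative. *)
Record rough_driver T p w C a da dda b db : Prop := {
  rd_p0 : 0 < p;
  rd_p3 : p < 3;
  rd_rc : root_control T p w;
  rd_C0 : 0 <= C;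
  rd_a : forall s t, 0 <= s -> s <= t -> t <= T -> C11 (C * w s t) (a s t) (da s t);
  rd_da : forall s t, 0 <= s -> s <= t -> t <= T -> C11 (C * w s t) (da s t) (dda s t);
  rd_b : forall s t, 0 <= s -> s <= t -> t <= T ->
    C11 (C * w s t ^+ 2) (b s t) (db s t);
  rd_chen1 : forall s u t x, 0 <= s -> s <= u -> u <= t -> t <= T ->
    a s t x = a s u x + a u t x;
  rd_chen2 : forall s u t x, 0 <= s -> s <= u -> u <= t -> t <= T ->
    b s t x = b s u x + b u t x + da u t x * a s u x }.

(** The map [y^natural] of the equation, as a function of the pair [(y, m)]. *)
Definition remainder a b y m s t : R :=
  y t - y s - a s t (y s) - b s t (y s) - (m t - m s).

(** What is used of a solution before the reflection condition comes in.  The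
    remainder is not assumed to be small on each interval, only along suitable
    partitions. *)
Record davie_solution T w C a b y m : Prop := {
  ds_y_bound : forall s t, 0 <= s -> s <= t -> t <= T -> `|y t - y s| <= C;
  ds_m_nd : forall s t, 0 <= s -> s <= t -> t <= T -> m s <= m t;
  ds_m_bound : forall s t, 0 <= s -> s <= t -> t <= T -> m t - m s <= C * w s t ^+ 2;
  ds_null : forall s t, 0 <= s -> s <= t -> t <= T ->
    null_on (fun u v => `|remainder a b y m u v|) s t }.


Lemma remainder_diag T p w C a da dda b db y m s (rd : rough_driver T p w C a da dda b db) : 0 <= s -> s <= T -> remainder a b y m s s = 0.
Proof.
have p0 := rd_p0 rd; have rc := rd_rc rd; have C0 := rd_C0 rd.
move=> s0 sT; have wE := rc_diag rc s0 sT.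
have := C11_bound (rd_a rd s0 (lexx _) sT) (y s).
have := C11_bound (rd_b rd s0 (lexx _) sT) (y s).
rewrite wE expr0n /= !mulr0 !normr_le0 => /eqP bE /eqP aE.
by rewrite /remainder bE aE !subrr.
Qed.

(** The increment of [a u t] from [y s] to [y u] is expanded at [y s]; its
    first-order part in [a s u (y s)] cancels against Chen's relation, which
    leaves a Taylor remainder, the rest of the increment of [y], and an increment
    of [b u t]. *)
Lemma remainder_delta2 T p w C a da dda b db y m s u t (rd : rough_driver T p w C a da dda b db) : 0 <= s -> s <= u -> u <= t -> t <= T ->
  delta2 (remainder a b y m) s u t =
    (a u t (y u) - a u t (y s) - da u t (y s) * (y u - y s))
    + da u t (y s) * (b s u (y s) + (m u - m s) + remainder a b y m s u)
    + (b u t (y u) - b u t (y s)).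
Proof.
have p0 := rd_p0 rd; have rc := rd_rc rd; have C0 := rd_C0 rd.
move=> s0 su ut tT; rewrite /delta2 /remainder.
rewrite (rd_chen1 rd (y s) s0 su ut tT) (rd_chen2 rd (y s) s0 su ut tT).
by ring.
Qed.

Lemma ds_increment T p w C a da dda b db y m s t (rd : rough_driver T p w C a da dda b db)
    (ds : davie_solution T w C a b y m) : 0 <= s -> s <= t -> t <= T ->
  `|y t - y s| <= 3 * C * w s t + `|remainder a b y m s t|.
Proof.
have p0 := rd_p0 rd; have rc := rd_rc rd; have C0 := rd_C0 rd.
move=> s0 st tT; have w0 := rc_ge0 rc s0 st tT; have w1 := rc_le1 rc s0 st tT.
have aC := C11_bound (rd_a rd s0 st tT) (y s).
have bC := C11_bound (rd_b rd s0 st tT) (y s).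
have mC := ds_m_bound ds s0 st tT; have m0 := ds_m_nd ds s0 st tT.
have -> : y t - y s = a s t (y s) + b s t (y s) + (m t - m s) + remainder a b y m s t.
  by rewrite /remainder; ring.
apply: le_trans (ler_normD _ _) _; rewrite lerD2r.
apply: le_trans (ler_normD _ _) _.
rewrite [`|m t - m s|]ger0_norm ?subr_ge0//.
have nab := ler_normD (a s t (y s)) (b s t (y s)).
have ww : C * w s t ^+ 2 <= C * w s t by rewrite ler_wpM2l// expr2 ler_piMl.
clear -nab ww aC bC mC; lra.
Qed.

Lemma ds_remainder_bounded T p w C a da dda b db y m s t (rd : rough_driver T p w C a da dda b db)
    (ds : davie_solution T w C a b y m) : 0 <= s -> s <= t -> t <= T ->
  `|remainder a b y m s t| <= 4 * C.
Proof.
have p0 := rd_p0 rd; have rc := rd_rc rd; have C0 := rd_C0 rd.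
move=> s0 st tT; have w0 := rc_ge0 rc s0 st tT; have w1 := rc_le1 rc s0 st tT.
have aC := C11_bound (rd_a rd s0 st tT) (y s).
have bC := C11_bound (rd_b rd s0 st tT) (y s).
have mC := ds_m_bound ds s0 st tT; have m0 := ds_m_nd ds s0 st tT.
have yC := ds_y_bound ds s0 st tT.
have Cw : C * w s t <= C by rewrite ler_piMr.
have Cww : C * w s t ^+ 2 <= C by rewrite ler_piMr// expr_le1.
have tri : `|remainder a b y m s t| <=
    `|y t - y s| + `|a s t (y s)| + `|b s t (y s)| + `|m t - m s|.
  do 2 (apply: le_trans (ler_normB _ _) _; rewrite lerD2r).
  exact: ler_normB.
apply: le_trans tri _.
rewrite [`|m t - m s|]ger0_norm ?subr_ge0//.
clear -aC bC mC yC Cw Cww; lra.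
Qed.

(** The remainder over [[s, u]] occurs quadratically in the Taylor term, but it
    is bounded, so one power can be traded for a constant. *)
Lemma remainder_delta2_bound T p w C a da dda b db y m s u t (rd : rough_driver T p w C a da dda b db)
    (ds : davie_solution T w C a b y m) : 0 <= s -> s <= u -> u <= t -> t <= T ->
  `|delta2 (remainder a b y m) s u t| <=
    (9 * C ^+ 3 + 9 * C ^+ 2 + 2 * C) *
      (1 * w s t ^+ 3 + 0 * w s t + `|remainder a b y m s u| * w s t).
Proof.
have p0 := rd_p0 rd; have rc := rd_rc rd; have C0 := rd_C0 rd.
move=> s0 su ut tT; rewrite (remainder_delta2 _ _ rd)//.
have u0 := le_trans s0 su; have uT := le_trans ut tT; have st := le_trans su ut.
set W := w s t; set g := remainder a b y m s u.
have W0 : 0 <= W := rc_ge0 rc s0 st tT.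
have W1 : W <= 1 := rc_le1 rc s0 st tT.
have w1 := rc_ge0 rc s0 su uT; have w2 := rc_ge0 rc u0 ut tT.
have wsu : w s u <= W by apply: (rc_mono p0 rc).
have wut : w u t <= W by apply: (rc_mono p0 rc).
have Cut : C * w u t <= C * W by rewrite ler_wpM2l.
have sq v : 0 <= v -> v <= W -> C * v ^+ 2 <= C * W ^+ 2.
  by move=> v0 vW; rewrite ler_wpM2l// lerXn2r ?nnegrE.
have CW0 : 0 <= C * W by rewrite mulr_ge0.
have yC := ds_y_bound ds s0 su uT.
have yw : `|y u - y s| <= 3 * C * W + `|g|.
  apply: le_trans (ds_increment rd ds s0 su uT) _.
  by rewrite lerD2r ler_wpM2l// mulr_ge0.
have t1 := C11_taylor (y s) (y u) (rd_a rd u0 ut tT).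
have t2 := C11_bound (rd_da rd u0 ut tT) (y s).
have t3 := C11_lip (y u) (y s) (rd_b rd u0 ut tT).
have t4 := C11_bound (rd_b rd s0 su uT) (y s).
have mC := ds_m_bound ds s0 su uT; have m0 := ds_m_nd ds s0 su uT.
have D0 := normr_ge0 (y u - y s); have g0 := normr_ge0 g.
set D := `|y u - y s| in yC yw t1 t3 D0.
have DD : D ^+ 2 <= 9 * C ^+ 2 * W ^+ 2 + 4 * C * `|g|.
  have h1 : D * D <= D * (3 * C * W + `|g|) by rewrite ler_wpM2l.
  have h2 : D * `|g| <= C * `|g| by rewrite ler_wpM2r.
  have h3 : 3 * (C * W) * D <= 3 * (C * W) * (3 * C * W + `|g|).
    by rewrite ler_wpM2l// mulr_ge0.
  have h4 : C * W * `|g| <= C * `|g| by rewrite ler_wpM2r// ler_piMr.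
  rewrite expr2; clear -h1 h2 h3 h4; lra.
have T1 : `|a u t (y u) - a u t (y s) - da u t (y s) * (y u - y s)| <=
    C * W * (9 * C ^+ 2 * W ^+ 2 + 4 * C * `|g|).
  by apply: le_trans t1 _; apply: ler_pM => //; rewrite ?mulr_ge0.
have T2 : `|da u t (y s) * (b s u (y s) + (m u - m s) + g)| <=
    C * W * (2 * (C * W ^+ 2) + `|g|).
  rewrite normrM; apply: ler_pM => //; first exact: le_trans t2 Cut.
  apply: le_trans (ler_normD _ _) _; rewrite lerD2r.
  apply: le_trans (ler_normD _ _) _.
  rewrite [`|m u - m s|]ger0_norm ?subr_ge0//.
  have := sq _ w1 wsu; clear -t4 mC; lra.
have T3 : `|b u t (y u) - b u t (y s)| <= C * W ^+ 2 * (3 * C * W + `|g|).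
  apply: le_trans t3 _; apply: ler_pM => //; last exact: sq.
  by rewrite mulr_ge0// exprn_ge0.
have T4 : C * W ^+ 2 * `|g| <= C * W * `|g|.
  by rewrite ler_wpM2r// ler_wpM2l// expr2 ler_piMl.
set X1 := _ - _ * _ in T1 *; set X2 := _ * _ in T2 *; set X3 := _ - _ in T3 *.
have tri := le_trans (ler_normD (X1 + X2) X3) (lerD (ler_normD X1 X2) (lexx _)).
apply: le_trans tri _.
have C2 : 0 <= C ^+ 2 * W ^+ 3 by rewrite mulr_ge0// exprn_ge0.
have C3 : 0 <= C * W ^+ 3 by rewrite mulr_ge0// exprn_ge0.
have C4 : 0 <= C ^+ 2 * (W * `|g|) by rewrite mulr_ge0// ?exprn_ge0// mulr_ge0.
have C5 : 0 <= C ^+ 3 * (W * `|g|) by rewrite mulr_ge0// ?exprn_ge0// mulr_ge0.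
clear -T1 T2 T3 T4 C2 C3 C4 C5; lra.
Qed.

(** On short intervals this is [sewing]; on the others [w s t] is bounded below
    and the remainder is bounded. *)
Lemma remainder_bound T p w C a da dda b db y m (rd : rough_driver T p w C a da dda b db)
    (ds : davie_solution T w C a b y m) : exists2 K, 0 <= K &
  forall s t, 0 <= s -> s <= t -> t <= T ->
    `|remainder a b y m s t| <= K * w s t ^+ 3.
Proof.
have p0 := rd_p0 rd; have rc := rd_rc rd; have C0 := rd_C0 rd.
have C'0 : 0 <= 9 * C ^+ 3 + 9 * C ^+ 2 + 2 * C.
  by rewrite !addr_ge0 ?mulr_ge0 ?exprn_ge0.
have [eta [K [eta0 K0 sew]]] := sewing p0 rc C'0 (rd_p3 rd).
exists (K + 4 * C / eta ^+ 3) => [|s t s0 st tT].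
  by rewrite addr_ge0 ?divr_ge0 ?mulr_ge0 ?exprn_ge0 ?(ltW eta0).
have w0 := rc_ge0 rc s0 st tT.
have w30 : 0 <= w s t ^+ 3 by rewrite exprn_ge0.
have [we|we] := leP (w s t) eta.
  have := sew (remainder a b y m) (fun _ _ => 0) 1 s t s0 st tT we ler01.
  rewrite mul1r mul0r addr0 => h; apply: le_trans (h _ _ _ _ _) _ => //.
  - by move=> c sc ct; apply: (remainder_diag _ _ rd); [exact: le_trans sc|exact: le_trans tT].
  - move=> c u d sc cu ud dt; apply: (remainder_delta2_bound rd ds) => //.
      exact: le_trans sc.
    exact: le_trans tT.
  - exact: (ds_null ds).
  - by rewrite addr0 ler_wpM2r// lerDl ?divr_ge0 ?mulr_ge0 ?exprn_ge0 ?(ltW eta0).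
have e3 : 0 < eta ^+ 3 by rewrite exprn_gt0.
apply: le_trans (ds_remainder_bounded rd ds s0 st tT) _.
apply: (@le_trans _ _ (4 * C / eta ^+ 3 * w s t ^+ 3)); last first.
  by rewrite ler_wpM2r// lerDr.
rewrite mulrAC ler_pdivlMr// ler_wpM2l ?mulr_ge0//.
by rewrite lerXn2r ?nnegrE ?(ltW we) ?(ltW eta0).
Qed.


(** The map [w ^+ 3] has finite [p/3]-variation, since its power [p/3] is the
    control [w `^ p], and [p/3 < 1]. *)
Lemma null_on_cube T p w K (g : R -> R -> R) s t : 0 < p -> p < 3 -> root_control T p w ->
  0 <= K -> 0 <= s -> s <= t -> t <= T ->
  (forall u v, s <= u -> u <= v -> v <= t -> `|g u v| <= K * w u v ^+ 3) ->
  null_on (fun u v => `|g u v|) s t.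
Proof.
move=> p0 p3 rc K0 s0 st tT gK q'E.
have w0 u v : s <= u -> u <= v -> v <= t -> 0 <= w u v.
  move=> su uv vt; apply: (rc_ge0 rc) => //; first exact: le_trans su.
  exact: le_trans tT.
pose q' := p / 3.
have q'0 : 0 < q' by rewrite divr_gt0.
have q'1 : q' < 1 by rewrite ltr_pdivrMr// mul1r.
apply: (@null_on_pvar R _ q' (K `^ q' * w s t `^ p) s t) => //.
- move=> x sx xt.
  apply: (@le_trans _ _ (psum (fun u v => K `^ q' * w u v `^ p) s x)).
    apply: (le_psum _ sx (lexx _)) => [//||u v su uv vt]; first by rewrite xt.
    have wuv := w0 _ _ su (ltW uv) vt.
    have <- : (K * w u v ^+ 3) `^ q' = K `^ q' * w u v `^ p.
      rewrite powRM ?exprn_ge0// -powR_mulrn// -powRrM.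
      by congr (_ * _ `^ _); rewrite mulrCA divff// mulr1.
    have Kw0 : 0 <= K * w u v ^+ 3 by rewrite mulr_ge0 ?exprn_ge0.
    apply: ge0_ler_powR; rewrite ?nnegrE// ?(ltW q'0)//.
    by apply: gK => //; exact: ltW.
  rewrite psumM ler_wpM2l ?powR_ge0// -xt.
  apply: (psum_superadditive (rc_super rc)) => //; last by rewrite xt.
  by move=> u u0 uT; exact: powR_ge0.
- move=> e e0; have K1 : 0 < K + 1 by rewrite ltr_wpDl.
  have [d d0 wd] := rc_small rc (divr_gt0 e0 K1).
  exists d => // u v su uv vt vud; have wuv := w0 _ _ su (ltW uv) vt.
  have u0 := le_trans s0 su; have vT := le_trans vt tT.
  have w1 := rc_le1 rc u0 (ltW uv) vT.
  have := wd _ _ u0 (ltW uv) vT vud; rewrite ltr_pdivlMr// => we.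
  apply: le_lt_trans (gK _ _ su (ltW uv) vt) _; apply: le_lt_trans we.
  rewrite mulrC; apply: ler_pM => //; rewrite ?exprn_ge0// ?lerDl//.
  by rewrite exprS ler_piMr// expr_le1.
Qed.

(** The polynomial bookkeeping of [remainder_difference]; [dz] stands for the
    increment of [y - y'], and the five summands on the left are the bounds of
    the Taylor, first-order and second-order parts. *)
Lemma difference_algebra (C E W Z k gm dz : R) : 0 <= C -> 0 <= E -> 0 <= W ->
  W <= 1 -> 0 <= Z -> 0 <= k -> 0 <= gm -> dz <= 2 * (C * W * Z) + k + gm ->
  C * W * (Z * (E * W) + dz) * (E * W) + C * W * (E * W) * dz +
  (C * W * (C * W ^+ 2 * Z + k + gm) + C * W * Z * (E * W ^+ 2)) +
  C * W ^+ 2 * (Z * (E * W) + dz) <=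
  (C * E ^+ 2 + 4 * C ^+ 2 * E + 4 * C * E + 3 * C ^+ 2 + 2 * C) *
  (Z * W ^+ 3 + k * W + gm * W).
Proof.
move=> C0 E0 W0 W1 Z0 k0 g0 dzB.
have W20 : 0 <= W ^+ 2 by rewrite exprn_ge0.
have CW : 0 <= (2 * C * E + C) * W ^+ 2 by rewrite mulr_ge0 ?addr_ge0 ?mulr_ge0.
have h := ler_wpM2l CW dzB.
have kW : W ^+ 2 * (k + gm) <= W * (k + gm).
  by rewrite ler_wpM2r ?addr_ge0// expr2 ler_piMl.
have CE : 0 <= 2 * C * E + C by rewrite addr_ge0 ?mulr_ge0.
have h2 := ler_wpM2l CE kW.
have mono c d : 0 <= c -> 0 <= d -> 0 <= c * (Z * W ^+ 3 + d * ((k + gm) * W)).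
  by move=> c0 d0; rewrite mulr_ge0 ?addr_ge0 ?mulr_ge0 ?exprn_ge0 ?addr_ge0.
have kg0 : 0 <= (k + gm) * W by rewrite mulr_ge0 ?addr_ge0.
have ZW0 : 0 <= Z * W ^+ 3 by rewrite mulr_ge0 ?exprn_ge0.
have C1 : 0 <= C * E ^+ 2 * ((k + gm) * W) by rewrite !mulr_ge0 ?exprn_ge0 ?addr_ge0.
have C2 : 0 <= C ^+ 2 * E * ((k + gm) * W) by rewrite !mulr_ge0 ?exprn_ge0 ?addr_ge0.
have C3 : 0 <= C * E * ((k + gm) * W) by rewrite !mulr_ge0 ?exprn_ge0 ?addr_ge0.
have C4 : 0 <= C ^+ 2 * ((k + gm) * W) by rewrite !mulr_ge0 ?exprn_ge0 ?addr_ge0.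
have D1 : 0 <= C * E * (Z * W ^+ 3) by rewrite !mulr_ge0 ?exprn_ge0.
have D2 : 0 <= C * (Z * W ^+ 3) by rewrite !mulr_ge0 ?exprn_ge0.
have D3 : C ^+ 2 * E * (Z * W ^+ 3 * W) <= C ^+ 2 * E * (Z * W ^+ 3).
  by rewrite ler_wpM2l ?mulr_ge0 ?exprn_ge0// ler_piMr.
have D4 : C * E * (Z * W ^+ 3 * W) <= C * E * (Z * W ^+ 3).
  by rewrite ler_wpM2l ?mulr_ge0// ler_piMr.
clear -h h2 C1 C2 C3 C4 D1 D2 D3 D4; lra.
Qed.
(** Linear in [Z] and in the increments of [m] and [m'] over [[s, u]]: the latter
    occur with the factor [w s t], so that they satisfy the hypotheses of
    [sewing] although nothing is known on their size relative to [Z]. *)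
Lemma remainder_difference T p w C K a da dda b db y m y' m'
    (rd : rough_driver T p w C a da dda b db)
    (ds : davie_solution T w C a b y m) (ds' : davie_solution T w C a b y' m') :
  0 <= K ->
  (forall s t, 0 <= s -> s <= t -> t <= T ->
    `|remainder a b y m s t| <= K * w s t ^+ 3) ->
  (forall s t, 0 <= s -> s <= t -> t <= T ->
    `|remainder a b y' m' s t| <= K * w s t ^+ 3) ->
  exists L, 0 <= L /\
  forall s u t Z, 0 <= s -> s <= u -> u <= t -> t <= T ->
    (forall r, s <= r -> r <= t -> `|y r - y' r| <= Z) ->
    `|delta2 (fun s t => remainder a b y m s t - remainder a b y' m' s t) s u t|
    <= L * (Z * w s t ^+ 3 + ((m u - m s) + (m' u - m' s)) * w s t +
            `|remainder a b y m s u - remainder a b y' m' s u| * w s t).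
Proof.
move=> K0 gK gK'.
have p0 := rd_p0 rd; have rc := rd_rc rd; have C0 := rd_C0 rd.
pose E := 3 * C + K.
have E0 : 0 <= E by rewrite addr_ge0 ?mulr_ge0.
exists (C * E ^+ 2 + 4 * C ^+ 2 * E + 4 * C * E + 3 * C ^+ 2 + 2 * C).
split; first by rewrite !addr_ge0 ?mulr_ge0 ?exprn_ge0.
move=> s u t Z s0 su ut tT yZ.
set k := (m u - m s) + (m' u - m' s).
pose gam s t := remainder a b y m s t - remainder a b y' m' s t.
rewrite -/gam -/(gam s u).
have st := le_trans su ut; have u0 := le_trans s0 su; have uT := le_trans ut tT.
have ys := yZ s (lexx _) st; have yu := yZ u su ut.
have Z0 : 0 <= Z := le_trans (normr_ge0 _) ys.
have -> : delta2 gam s u t =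
    delta2 (remainder a b y m) s u t - delta2 (remainder a b y' m') s u t.
  by rewrite /delta2 /gam; ring.
rewrite !(remainder_delta2 _ _ rd)//.
have g1 : `|remainder a b y m s u| <= K * w s u ^+ 3 := gK s u s0 su uT.
have g2 : `|remainder a b y' m' s u| <= K * w s u ^+ 3 := gK' s u s0 su uT.
have gamE : gam s u = remainder a b y m s u - remainder a b y' m' s u by [].
move: g1 g2 gamE.
have inc := ds_increment rd ds s0 su uT.
have inc' := ds_increment rd ds' s0 su uT.
move: inc inc'.
set g := remainder a b y m s u; set g' := remainder a b y' m' s u.
set gm := gam s u; set W := w s t => inc inc' g1 g2 gamE.
have W0 : 0 <= W := rc_ge0 rc s0 st tT.
have W1 : W <= 1 := rc_le1 rc s0 st tT.
have w1 := rc_ge0 rc s0 su uT; have w2 := rc_ge0 rc u0 ut tT.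
have wsu : w s u <= W by apply: (rc_mono p0 rc).
have wut : w u t <= W by apply: (rc_mono p0 rc).
have Cut : C * w u t <= C * W by rewrite ler_wpM2l.
have CW0 : 0 <= C * W by rewrite mulr_ge0.
have sq v : 0 <= v -> v <= W -> C * v ^+ 2 <= C * W ^+ 2.
  by move=> v0 vW; rewrite ler_wpM2l// lerXn2r ?nnegrE.
have wW2 : C * W ^+ 2 <= C * W by rewrite ler_wpM2l// expr2 ler_piMl.
have KW n : (0 < n)%N -> (n <= 3)%N -> K * w s u ^+ 3 <= K * W ^+ n.
  move=> n0 n3; rewrite ler_wpM2l//; apply: (@le_trans _ _ (W ^+ 3)).
    by rewrite lerXn2r ?nnegrE.
  by apply: ler_wiXn2l.
have DE (x : R) : `|x| <= K * w s u ^+ 3 -> 3 * C * w s u + `|x| <= E * W.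
  move=> xK; have := le_trans xK (KW 1%N isT isT).
  have : 3 * C * w s u <= 3 * C * W by rewrite ler_wpM2l// mulr_ge0.
  rewrite /E expr1; clear; lra.
have {DE} [D1 D2] := (le_trans inc (DE _ g1), le_trans inc' (DE _ g2)).
have mC := ds_m_bound ds' s0 su uT; have m0 := ds_m_nd ds s0 su uT.
have m0' := ds_m_nd ds' s0 su uT.
have mk : `|(m u - m s) - (m' u - m' s)| <= k.
  by rewrite /k ler_norml; clear -m0 m0'; lra.
have k0 : 0 <= k := le_trans (normr_ge0 _) mk.
have bsu := C11_lip (y s) (y' s) (rd_b rd s0 su uT).
have asu := C11_lip (y s) (y' s) (rd_a rd s0 su uT).
have lipZ c : 0 <= c -> c * `|y s - y' s| <= c * Z by move=> c0; rewrite ler_wpM2l.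
have aZ : `|a s u (y s) - a s u (y' s)| <= C * W * Z.
  by apply: le_trans asu _; apply: ler_pM => //; rewrite ?mulr_ge0// ler_wpM2l.
have bZ : `|b s u (y s) - b s u (y' s)| <= C * W ^+ 2 * Z.
  apply: le_trans bsu _; apply: ler_pM => //; last exact: sq.
  by rewrite mulr_ge0// exprn_ge0.
set dz := (y u - y s) - (y' u - y' s).
have dzE : dz = (a s u (y s) - a s u (y' s)) + (b s u (y s) - b s u (y' s))
    + ((m u - m s) - (m' u - m' s)) + gm.
  by rewrite /dz gamE /g /g' /remainder; ring.
have dzB : `|dz| <= 2 * (C * W * Z) + k + `|gm|.
  rewrite dzE; apply: le_trans (ler_normD _ _) _; rewrite lerD2r.
  apply: le_trans (ler_normD _ _) _; apply: lerD mk.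
  apply: le_trans (ler_normD _ _) _.
  have : C * W ^+ 2 * Z <= C * W * Z by rewrite ler_wpM2r.
  clear -aZ bZ; lra.
have T1 := C11_taylor_four_point (rd_a rd u0 ut tT) (rd_da rd u0 ut tT) ys yu.
have rE : `|(b s u (y s) + (m u - m s) + g) - (b s u (y' s) + (m' u - m' s) + g')|
    <= C * W ^+ 2 * Z + k + `|gm|.
  have -> : b s u (y s) + (m u - m s) + g - (b s u (y' s) + (m' u - m' s) + g') =
     (b s u (y s) - b s u (y' s)) + ((m u - m s) - (m' u - m' s)) + gm.
    by rewrite gamE; ring.
  apply: le_trans (ler_normD _ _) _; rewrite lerD2r.
  by apply: le_trans (ler_normD _ _) _; apply: lerD.
have r'E : `|b s u (y' s) + (m' u - m' s) + g'| <= E * W ^+ 2.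
  apply: le_trans (ler_normD _ _) _.
  have h1 := ler_normD (b s u (y' s)) (m' u - m' s).
  rewrite [`|m' u - m' s|]ger0_norm ?subr_ge0// in h1.
  have h2 := C11_bound (rd_b rd s0 su uT) (y' s).
  have h3 := sq _ w1 wsu; have h4 := le_trans g2 (KW 2%N isT isT).
  have h5 : 0 <= C * W ^+ 2 by rewrite mulr_ge0// exprn_ge0.
  rewrite /E; clear -h1 h2 h3 h4 h5 mC; lra.
have daC := C11_bound (rd_da rd u0 ut tT) (y s).
have daZ := C11_lip (y s) (y' s) (rd_da rd u0 ut tT).
have T3 := C11_four_point (rd_b rd u0 ut tT) ys yu.
move: T1 T3; rewrite -/dz.
set r := b s u (y s) + _ + g in rE *; set r' := b s u (y' s) + _ + g' in rE r'E *.
set A1 := a u t (y u) - _ - _; set A2 := a u t (y' u) - _ - _.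
set B1 := b u t (y u) - _; set B2 := b u t (y' u) - _ => T1 T3.
set P1 := da u t (y s) in daC daZ *; set P2 := da u t (y' s) in daZ *.
have -> : A1 + P1 * r + B1 - (A2 + P2 * r' + B2) =
    (A1 - A2) + (P1 * (r - r') + (P1 - P2) * r') + (B1 - B2) by ring.
have dz0 := normr_ge0 dz; have gm0 := normr_ge0 gm.
have EW0 : 0 <= E * W by rewrite mulr_ge0.
set Y := `|y u - y s| in D1 T1 T3; set Y' := `|y' u - y' s| in D2 T1.
have [Y0 Y'0] : 0 <= Y /\ 0 <= Y' by split; apply: normr_ge0.
have CWut : 0 <= C * w u t by rewrite mulr_ge0.
have ZEdz : Z * Y + `|dz| <= Z * (E * W) + `|dz| by rewrite lerD2r ler_wpM2l.
have ZY0 : 0 <= Z * Y + `|dz| by rewrite addr_ge0// mulr_ge0.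
have T1' : `|A1 - A2| <=
    C * W * (Z * (E * W) + `|dz|) * (E * W) + C * W * (E * W) * `|dz|.
  apply: le_trans T1 _; apply: lerD.
    by apply: ler_pM => //; rewrite ?mulr_ge0//; apply: ler_pM.
  by rewrite ler_wpM2r//; apply: ler_pM.
have T2' : `|P1 * (r - r') + (P1 - P2) * r'| <=
    C * W * (C * W ^+ 2 * Z + k + `|gm|) + C * W * Z * (E * W ^+ 2).
  apply: le_trans (ler_normD _ _) _; rewrite !normrM; apply: lerD.
    by apply: ler_pM => //; exact: le_trans daC Cut.
  apply: ler_pM => //; apply: le_trans daZ _.
  by apply: ler_pM.
have T3' : `|B1 - B2| <= C * W ^+ 2 * (Z * (E * W) + `|dz|).
  apply: le_trans T3 _; apply: ler_pM => //; last exact: sq.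
  by rewrite mulr_ge0// exprn_ge0.
have tri := le_trans (ler_normD (A1 - A2 + (P1 * (r - r') + (P1 - P2) * r')) (B1 - B2))
  (lerD (ler_normD _ _) (lexx _)).
apply: le_trans tri _; apply: le_trans (lerD (lerD T1' T2') T3') _.
exact: difference_algebra.
Qed.

End remainders.

(** * Comparison of two reflected solutions *)

Section comparison.
Context {R : realType}.
Implicit Types (T p C K L Z s t u r : R) (w : R -> R -> R).
Implicit Types (a da dda b db : R -> R -> R -> R) (y m z : R -> R).

Lemma last_nonpositive_time T z t1 : 0 <= t1 -> t1 <= T ->
  (forall e, 0 < e -> exists2 d, 0 < d & forall s t, 0 <= s -> s <= t ->
     t <= T -> t - s < d -> `|z t - z s| < e) ->
  z 0 <= 0 -> 0 < z t1 ->
  exists s, [/\ 0 <= s, s < t1, z s = 0 & forall t, s < t -> t <= t1 -> 0 < z t].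
Proof.
move=> t10 t1T zc z0 zt1.
pose S : set R := [set t : R | [/\ 0 <= t, t <= t1 & z t <= 0]]%classic.
have supS : has_sup S.
  by split; [exists 0; split|exists t1 => t [_ ? _]].
pose s := sup S.
have Ss t : S t -> t <= s by apply: ub_le_sup; case: supS.
have s0 : 0 <= s by apply: Ss; split.
have st1 : s <= t1 by apply: ge_sup => [|t [_ ? _]//]; case: supS.
have sT := le_trans st1 t1T.
have pos t : s < t -> t <= t1 -> 0 < z t.
  move=> st tt1; rewrite ltNge; apply/negP => zt.
  have : t <= s by apply: Ss; split=> //; exact: le_trans (ltW st).
  by rewrite leNgt st.
have zs : z s <= 0.
  rewrite leNgt; apply/negP => zs; have [d d0 zd] := zc _ zs.
  have [t St ts] := sup_adherent d0 supS.
  have ts' := Ss _ St; have [t0 _ zt] := St.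
  have := zd t s t0 ts' sT; rewrite ltrBlDl -ltrBlDr => /(_ ts).
  by rewrite ltr_norml => /andP[_]; rewrite ltrBlDr ltrDl ltNge zt.
have s1 : s < t1 by rewrite lt_neqAle st1 andbT; apply: contraTneq zt1 => <-; rewrite -leNgt.
exists s; split=> //; apply/eqP; rewrite eq_le zs /= leNgt; apply/negP => zs'.
have e0 : 0 < - z s by rewrite oppr_gt0.
have [d d0 zd] := zc _ e0.
pose t := Num.min t1 (s + d / 2).
have st : s < t by rewrite lt_min s1 /= ltrDl divr_gt0.
have tt1 : t <= t1 by rewrite ge_min lexx.
have tsd : t - s < d.
  have : t <= s + d / 2 by rewrite ge_min lexx orbT.
  clear -d0; lra.
have := zd s t s0 (ltW st) (le_trans tt1 t1T) tsd.
rewrite ltr_norml => /andP[_]; have := pos t st tt1; clear; lra.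
Qed.

Lemma ds_continuous T p w C a da dda b db y m
    (rd : rough_driver T p w C a da dda b db) (ds : davie_solution T w C a b y m) :
  forall e, 0 < e -> exists2 d, 0 < d & forall s t, 0 <= s -> s <= t ->
    t <= T -> t - s < d -> `|y t - y s| < e.
Proof.
have [K K0 gK] := remainder_bound rd ds; have C0 := rd_C0 rd.
move=> e e0; have CK : 0 < 3 * C + K + 1 by rewrite ltr_wpDl// addr_ge0 ?mulr_ge0.
have [d d0 wd] := rc_small (rd_rc rd) (divr_gt0 e0 CK).
exists d => // s t s0 st tT tsd.
have := wd _ _ s0 st tT tsd; rewrite ltr_pdivlMr// => we.
have w0 := rc_ge0 (rd_rc rd) s0 st tT; have w1 := rc_le1 (rd_rc rd) s0 st tT.
have inc := ds_increment rd ds s0 st tT; have g := gK s t s0 st tT.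
have Kw : K * w s t ^+ 3 <= K * w s t by rewrite ler_wpM2l// exprS ler_piMr// expr_le1.
clear -we inc g Kw w0; lra.
Qed.

(** While [y' < y], the reflection term [m] is constant and [m'] can only push the
    smaller of the two paths upwards, in favour of [y <= y']. *)
Lemma comparison T p w C a da dda b db y m y' m'
    (rd : rough_driver T p w C a da dda b db)
    (ds : davie_solution T w C a b y m) (ds' : davie_solution T w C a b y' m') :
  y 0 = y' 0 ->
  (forall t, 0 <= t -> t <= T -> 0 <= y' t) ->
  (forall s t, 0 <= s -> s <= t -> t <= T ->
    (forall u, s < u -> u <= t -> 0 < y u) -> m t = m s) ->
  forall t, 0 <= t -> t <= T -> y t <= y' t.
Proof.
move=> y00 y'0 mflat t1 t10 t1T; rewrite leNgt; apply/negP => yt1.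
have p0 := rd_p0 rd; have rc := rd_rc rd; have C0 := rd_C0 rd.
have [K1 K10 gK1] := remainder_bound rd ds.
have [K2 K20 gK2] := remainder_bound rd ds'.
pose K := K1 + K2; have K0 : 0 <= K by rewrite addr_ge0.
have gK s t : 0 <= s -> s <= t -> t <= T -> `|remainder a b y m s t| <= K * w s t ^+ 3.
  move=> s0 st tT; apply: le_trans (gK1 _ _ s0 st tT) _.
  by rewrite ler_wpM2r ?exprn_ge0 ?(rc_ge0 rc)// lerDl.
have gK' s t : 0 <= s -> s <= t -> t <= T -> `|remainder a b y' m' s t| <= K * w s t ^+ 3.
  move=> s0 st tT; apply: le_trans (gK2 _ _ s0 st tT) _.
  by rewrite ler_wpM2r ?exprn_ge0 ?(rc_ge0 rc)// lerDr.
have [L [L0 dgam]] := remainder_difference rd ds ds' K0 gK gK'.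
have [eta [M [eta0 M0 sew]]] := sewing p0 rc L0 (rd_p3 rd).
pose z t := y t - y' t.
have zc e : 0 < e -> exists2 d, 0 < d & forall s t, 0 <= s -> s <= t ->
    t <= T -> t - s < d -> `|z t - z s| < e.
  move=> e0; have e20 : 0 < e / 2 by rewrite divr_gt0.
  have [d d0 yd] := ds_continuous rd ds e20.
  have [d' d'0 yd'] := ds_continuous rd ds' e20.
  exists (Num.min d d') => [|s t s0 st tT]; first by rewrite lt_min d0.
  rewrite lt_min => /andP[td td'].
  have -> : z t - z s = (y t - y s) - (y' t - y' s) by rewrite /z; ring.
  apply: le_lt_trans (ler_normB _ _) _.
  have := yd _ _ s0 st tT td; have := yd' _ _ s0 st tT td'; clear; lra.
have z00 : z 0 <= 0 by rewrite /z y00 subrr.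
have zt1 : 0 < z t1 by rewrite subr_gt0.
have [s [s0 st1 zs zpos]] := last_nonpositive_time t10 t1T zc z00 zt1.
have M10 : 0 < 4 * (M + 1) by rewrite mulr_gt0// ltr_wpDl.
have th0 : 0 < Num.min eta (4 * (M + 1))^-1 by rewrite lt_min eta0 invr_gt0.
have [d d0 wd] := rc_small rc th0.
pose r := Num.min t1 (s + d / 2).
have sr : s < r by rewrite lt_min st1 /= ltrDl divr_gt0.
have rt1 : r <= t1 by rewrite ge_min lexx.
have rT := le_trans rt1 t1T; have sT := le_trans (ltW sr) rT.
have rsd : r - s < d.
  have : r <= s + d / 2 by rewrite ge_min lexx orbT.
  clear -d0; lra.
have ysy's : y s = y' s by apply/eqP; rewrite -subr_eq0 -/(z s) zs.
have zge0 u : s <= u -> u <= r -> 0 <= z u.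
  rewrite le_eqVlt => /predU1P[<-|su] ur; first by rewrite zs.
  by apply/ltW/zpos => //; exact: le_trans rt1.
have mE u : s <= u -> u <= r -> m u = m s.
  move=> su ur; apply: mflat => //; first exact: le_trans rT.
  move=> v sv vu; have vr := le_trans vu ur.
  have := zpos v sv (le_trans vr rt1).
  have := y'0 v (le_trans s0 (ltW sv)) (le_trans vr rT).
  rewrite /z; clear; lra.
pose gam s t := remainder a b y m s t - remainder a b y' m' s t.
pose k u v := (m v - m u) + (m' v - m' u).
pose S : set R := [set z u | u in [set u | s <= u <= r]]%classic.
have supS : has_sup S.
  split; first by exists (z s), s => //=; rewrite lexx ltW.
  exists (2 * C) => _ [u /andP[su ur] <-].
  have uT := le_trans ur rT.
  have h := ds_y_bound ds s0 su uT; have h' := ds_y_bound ds' s0 su uT.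
  have -> : z u = (y u - y s) - (y' u - y' s) by rewrite /z ysy's; ring.
  apply: le_trans (ler_norm _) _; apply: le_trans (ler_normB _ _) _.
  clear -h h'; lra.
pose Z := sup S.
have zZ u : s <= u -> u <= r -> z u <= Z.
  by move=> su ur; apply: ub_le_sup; [case: supS|exists u => //=; rewrite su].
have Z0 : 0 <= Z by apply: le_trans (zge0 s (lexx _) (ltW sr)) (zZ _ _ _); rewrite // ltW.
(* [z u] and [m' u - m' s] are nonnegative with sum [gam s u], and the bound on
   [gam s u] is at most a quarter of [Z + (m' u - m' s)] *)
have quarter u : s <= u -> u <= r -> z u <= Z / 4.
  move=> su ur; have uT := le_trans ur rT.
  have usd : u - s < d by apply: le_lt_trans rsd; rewrite lerD2r.
  have := wd s u s0 su uT usd; rewrite lt_min => /andP[weta wM].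
  have w0 := rc_ge0 rc s0 su uT; have w1 := rc_le1 rc s0 su uT.
  have gamE : gam s u = z u + (m' u - m' s).
    by rewrite /gam /remainder /z ysy's mE//; ring.
  have m'0 : 0 <= m' u - m' s by rewrite subr_ge0 (ds_m_nd ds').
  have knn c e : s <= c -> c <= e -> e <= u -> 0 <= k c e.
    move=> sc ce eu; have c0 := le_trans s0 sc; have eT := le_trans eu uT.
    by rewrite addr_ge0 ?subr_ge0 ?(ds_m_nd ds)// (ds_m_nd ds').
  have gle : `|gam s u| <= M * (Z * w s u ^+ 3 + k s u * w s u).
    apply: sew => //; first exact: ltW.
    - by move=> c v e _ _ _ _; rewrite /k; clear; lra.
    - move=> c sc cu; have c0 := le_trans s0 sc; have cT := le_trans cu uT.
      by rewrite /gam !(remainder_diag _ _ rd)// subrr.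
    - move=> c v e sc cv ve eu.
      have c0 := le_trans s0 sc; have eT := le_trans eu uT.
      have ce := le_trans cv ve.
      apply: le_trans (dgam c v e Z c0 cv ve eT _) _.
        move=> x cx xe; have sx := le_trans sc cx.
        have xr := le_trans xe (le_trans eu ur).
        by rewrite -/(z x) ger0_norm; [apply: zZ|apply: zge0].
      rewrite ler_wpM2l// lerD2r lerD2l ler_wpM2r ?(rc_ge0 rc)//.
      have kve := knn v e (le_trans sc cv) ve eu.
      by move: kve; rewrite /k; clear; lra.
    - apply: (null_on_cube p0 (rd_p3 rd) rc (_ : 0 <= K + K)) => //; first exact: addr_ge0.
      move=> x v sx xv vu; have x0 := le_trans s0 sx; have vT := le_trans vu uT.
      apply: le_trans (ler_normB _ _) _.
      by rewrite mulrDl lerD ?gK ?gK'.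
  have kE : k s u = m' u - m' s by rewrite /k mE// subrr add0r.
  have wM' : M * w s u <= 4^-1.
    have M1 : M <= M + 1 by rewrite lerDl.
    apply: (@le_trans _ _ ((M + 1) * (4 * (M + 1))^-1)).
      by apply: ler_pM => //; exact: ltW.
    rewrite invfM mulrCA divff ?mulr1//.
    by rewrite gt_eqF// ltr_wpDl.
  have h : M * (Z * w s u ^+ 3 + k s u * w s u) <= 4^-1 * (Z + (m' u - m' s)).
    apply: (@le_trans _ _ (M * w s u * (Z + (m' u - m' s)))); last first.
      by rewrite ler_wpM2r// addr_ge0.
    rewrite -mulrA ler_wpM2l// kE mulrDr [w s u * Z]mulrC [w s u * (_ - _)]mulrC lerD2r.
    by rewrite ler_wpM2l// exprS ler_piMr// expr_le1.
  have := le_trans gle h; rewrite gamE ger0_norm; last by rewrite addr_ge0 ?zge0.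
  move: m'0; clear; lra.
have : Z <= Z / 4.
  apply: ge_sup => [|_ [v /andP[sv vr] <-]]; first by case: supS.
  exact: quarter.
have := zZ r (ltW sr) (lexx _); have := zpos r sr rt1; clear; lra.
Qed.

(** The increments of [m' - m] are additive, and they are differences of
    remainders, whose partition sums are arbitrarily small. *)
Lemma reflection_determined T p w C a da dda b db y m y' m'
    (rd : rough_driver T p w C a da dda b db)
    (ds : davie_solution T w C a b y m) (ds' : davie_solution T w C a b y' m') :
  (forall t, 0 <= t -> t <= T -> y t = y' t) -> m 0 = m' 0 ->
  forall t, 0 <= t -> t <= T -> m t = m' t.
Proof.
move=> yy' m00 t t0 tT.
have p0 := rd_p0 rd; have rc := rd_rc rd.
have [K1 K10 gK1] := remainder_bound rd ds.
have [K2 K20 gK2] := remainder_bound rd ds'.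
pose n s := m' s - m s.
have nK u v : 0 <= u -> u <= v -> v <= t -> `|n v - n u| <= (K1 + K2) * w u v ^+ 3.
  move=> u0 uv vt; have vT := le_trans vt tT.
  have -> : n v - n u = remainder a b y m u v - remainder a b y' m' u v.
    by rewrite /n /remainder !yy'//; [ring|exact: le_trans vT|exact: le_trans uv].
  by apply: le_trans (ler_normB _ _) _; rewrite mulrDl lerD ?gK1 ?gK2.
have nnull : null_on (fun u v => `|n v - n u|) 0 t.
  by apply: (null_on_cube p0 (rd_p3 rd) rc (addr_ge0 K10 K20)).
have nt : `|n t - n 0| <= 0.
  apply/ler_addgt0Pl => e e0; rewrite addr0.
  have [x [x0 xt xe]] := nnull e e0.
  apply: le_trans xe; rewrite -xt -psum_telescope.
  elim: x 0 {x0 xt} => [|c x IH] c0 /=; first by rewrite normr0.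
  by apply: le_trans (ler_normD _ _) _; rewrite lerD2l.
move: nt; rewrite normr_le0 subr_eq0 /n m00 subrr subr_eq0 => /eqP.
exact: esym.
Qed.

End comparison.

(** * The control of a map of finite variation *)

Section variation.
Context {R : realType} {E : normedModType R}.
Implicit Types (q s t u a b M : R) (g : R -> R -> E) (x : seq R) (I : set R).

Lemma pvar_sumE q g a b x :
  pvar_sum q g a b x = psum (fun u v => `|g u v| `^ q) a x.
Proof.
rewrite /pvar_sum; elim: x a => [|c x IH] a /=; first by rewrite big_ord0.
by rewrite big_ord_recl /= IH.
Qed.

Lemma pvar_sums_ge0 q I g M : pvar_sums q I g M -> 0 <= M.
Proof.
move=> [a [b [x [_ _ [ax _] ->]]]]; rewrite pvar_sumE.
by apply: psum_ge0 => // *; exact: powR_ge0.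
Qed.

Lemma pvar_sums_path q s t a x g : s <= a -> path <%R a x -> last a x <= t ->
  pvar_sums q `[s, t]%classic g (psum (fun u v => `|g u v| `^ q) a x).
Proof.
move=> sa ax xt; have al := path_lt_last ax.
exists a, (last a x), x; split; rewrite /= ?in_itv /= ?pvar_sumE//.
- by rewrite sa (le_trans al).
- by rewrite xt (le_trans sa).
Qed.

Lemma pvar_sums_sub q I I' g : (I `<=` I')%classic ->
  (pvar_sums q I g `<=` pvar_sums q I' g)%classic.
Proof.
by move=> II' _ [a [b [x [/II' Ia /II' Ib ? ->]]]]; exists a, b, x.
Qed.

Lemma pvar_sums_Vnorm q I g M : 0 < q -> pvar_sums q I g M ->
  (M%:E <= Vnorm q I g `^ q)%E.
Proof.
move=> q0 SM; have M0 := pvar_sums_ge0 SM.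
have : ((M `^ q^-1)%:E <= Vnorm q I g)%E by apply: ereal_sup_ubound; exists M.
move=> h; have -> : M%:E = ((M `^ q^-1)%:E `^ q)%E.
  by rewrite poweR_EFin -powRrM mulVf ?gt_eqF// powRr1.
have P0 : (0 <= (M `^ q^-1)%:E)%E by rewrite lee_fin powR_ge0.
apply: (gt0_ler_poweR (ltW q0)) => //; rewrite in_itv /= leey andbT//.
exact: le_trans h.
Qed.

Lemma pvar_sums_bounded q I g : 0 < q -> Vbar2 q I g ->
  exists M, ubound (pvar_sums q I g) M.
Proof.
move=> q0 Vg; exists (fine (Vnorm q I g `^ q)%E) => M SM.
have fin : (Vnorm q I g `^ q)%E \is a fin_num.
  by rewrite ge0_fin_numE ?poweR_ge0// poweR_lty.
by rewrite -lee_fin fineK//; exact: pvar_sums_Vnorm.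
Qed.

(** A real-valued substitute for [Vcontrol]: the supremum of the sums themselves
    instead of the power [q] of the supremum of their [q]-th roots, which makes
    superadditivity a statement about concatenation of partitions. *)
Definition variation_control q g s t : R := sup (pvar_sums q `[s, t]%classic g).

Section on_interval.
Variables (q T : R) (g : R -> R -> E).
Hypotheses (q0 : 0 < q) (Vg : V2 q `[0, T]%classic g).

Lemma has_sup_variation s t : 0 <= s -> s <= t -> t <= T ->
  has_sup (pvar_sums q `[s, t]%classic g).
Proof.
move=> s0 st tT; split.
  by exists (psum (fun u v => `|g u v| `^ q) s [::]); apply: pvar_sums_path.
have [M MU] := pvar_sums_bounded q0 Vg.1; exists M => S /pvar_sums_sub SS.
apply: MU; apply: SS => u; rewrite /= !in_itv /= => /andP[su ut].
by rewrite (le_trans s0)//= (le_trans ut).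
Qed.

Lemma variation_control_ub s t S : 0 <= s -> s <= t -> t <= T ->
  pvar_sums q `[s, t]%classic g S -> S <= variation_control q g s t.
Proof. by move=> s0 st tT; apply: ub_le_sup; case: (has_sup_variation s0 st tT). Qed.

Lemma variation_control_ge0 s t : 0 <= s -> s <= t -> t <= T ->
  0 <= variation_control q g s t.
Proof.
move=> s0 st tT; apply: variation_control_ub => //.
exact: (@pvar_sums_path q s t s [::]).
Qed.

Lemma norm_le_variation_control s t : 0 <= s -> s < t -> t <= T ->
  `|g s t| `^ q <= variation_control q g s t.
Proof.
move=> s0 st tT; apply: variation_control_ub => //; first exact: ltW.
rewrite -[X in pvar_sums _ _ _ X]addr0; apply: (@pvar_sums_path q s t s [:: t]) => //=.
by rewrite st.
Qed.

Lemma variation_control_superadditive : superadditive T (variation_control q g).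
Proof.
move=> s u t s0 su ut tT; have u0 := le_trans s0 su; have uT := le_trans ut tT.
rewrite -lerBrDr; apply: ge_sup => [|S1 [a1 [b1 [x1 [+ + [ax1 /eqP xb1] ->]]]]].
  by case: (has_sup_variation s0 su uT).
rewrite lerBrDr addrC -lerBrDr.
rewrite /= !in_itv /= => /andP[sa1 a1u] /andP[sb1 b1u].
apply: ge_sup => [|S2 [a2 [b2 [x2 [+ + [ax2 /eqP xb2] ->]]]]].
  by case: (has_sup_variation u0 ut tT).
rewrite /= !in_itv /= => /andP[ua2 a2t] /andP[ub2 b2t].
rewrite lerBrDr !pvar_sumE addrC.
have b1a2 := le_trans b1u ua2.
(* two partitions of adjacent intervals are joined, with one more step in
   between when they do not touch *)
pose x := if b1 == a2 then x1 ++ x2 else x1 ++ a2 :: x2.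
have px : path <%R a1 x /\ last a1 x <= t.
  rewrite /x; case: eqP => [ba|/eqP ba].
    by rewrite cat_path last_cat ax1 xb1 ba ax2 xb2.
  by rewrite cat_path last_cat /= ax1 xb1 lt_neqAle ba b1a2 ax2 xb2.
apply: (@le_trans _ _ (psum (fun u v => `|g u v| `^ q) a1 x)).
  rewrite /x; case: eqP => [ba|/eqP ba]; rewrite psum_cat xb1 /= ?ba//.
  by rewrite lerD2l lerDr powR_ge0.
apply: variation_control_ub => //; first exact: le_trans ut.
by apply: pvar_sums_path; case: px.
Qed.

Lemma variation_control_small e : 0 < e -> exists2 d, 0 < d &
  forall s t, 0 <= s -> s <= t -> t <= T -> t - s < d ->
    variation_control q g s t <= e.
Proof.
move=> e0; have [d d0 gd] := Vg.2 e e0; exists d => // s t s0 st tT tsd.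
have I u : 0 <= u -> u <= T -> `[0, T]%classic u by move=> *; rewrite /= in_itv /=; apply/andP.
have := gd s t (I _ s0 (le_trans st tT)) (I _ (le_trans s0 st) tT) st tsd.
move=> lte; apply: ge_sup => [|S SS]; first by case: (has_sup_variation s0 st tT).
have := le_lt_trans (pvar_sums_Vnorm q0 SS) lte.
by rewrite lte_fin => /ltW.
Qed.

End on_interval.
End variation.

(** * From a countable cover by intervals to the whole interval *)

Section countable_cover.
Context {R : realType}.
Implicit Types (s t u b e T : R) (h : R -> R -> R) (J : nat -> set R).

(** How many ends of the set [A] have been passed at time [t]: the left end as soon
    as [t] has reached a point of [A], the right end once [t] is beyond all of
    them. *)
Definition passed (A : set R) t : nat :=
  `[< exists2 x, A x & x <= t >] + `[< forall x, A x -> x < t >].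

Lemma le_passed (A : set R) t t' : t <= t' -> (passed A t <= passed A t')%N.
Proof.
move=> tt'; apply: leq_add; (case: asboolP => // H; rewrite asboolT//).
  by have [x Ax xt] := H; exists x => //; exact: le_trans tt'.
by move=> x /H xt; exact: lt_le_trans tt'.
Qed.

Lemma passed_min (A : set R) t b : A b -> t < b -> (forall x, A x -> b <= x) ->
  (passed A t < passed A b)%N.
Proof.
move=> Ab tb bA; rewrite /passed [in X in (X < _)%N]asboolF.
  rewrite asboolF; last by move=> /(_ b Ab); rewrite ltNge (ltW tb).
  by rewrite asboolT//; exists b.
by move=> [x /bA bx xt]; have := le_trans bx xt; rewrite leNgt tb.
Qed.

Lemma passed_max (A : set R) t b : A b -> b < t -> (forall x, A x -> x <= b) ->
  (passed A b < passed A t)%N.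
Proof.
move=> Ab bt Ab'; rewrite /passed [X in (_ + nat_of_bool X < _)%N]asboolF; last first.
  by move=> /(_ b Ab); rewrite ltxx.
rewrite [in X in (X < _)%N]asboolT; last by exists b.
rewrite asboolT; last by exists b => //; exact: ltW.
by rewrite asboolT// => x /Ab' xb; exact: le_lt_trans bt.
Qed.

Lemma passed_le2 (A : set R) t : (passed A t <= 2)%N.
Proof. by rewrite /passed; case: `[< _ >]; case: `[< _ >]. Qed.

(** The total price, at time [t], of the steps made across the ends of
    [J 0, ..., J (n - 1)]. *)
Definition toll e J (n : nat) t : R :=
  \sum_(k < n) e * 2^-1 ^+ k * (passed (J k) t)%:R.

Lemma le_toll e J n n' t t' : 0 <= e -> (n <= n')%N -> t <= t' ->
  toll e J n t <= toll e J n' t'.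
Proof.
move=> e0 nn' tt'; rewrite /toll -(subnKC nn') big_split_ord /= -[leLHS]addr0.
have w0 k : 0 <= e * 2^-1 ^+ k by rewrite mulr_ge0// exprn_ge0.
apply: lerD; last by apply: sumr_ge0 => i _; rewrite mulr_ge0.
by apply: ler_sum => i _; rewrite ler_wpM2l// ler_nat le_passed.
Qed.

(** Crossing an end of [J k] increases [passed (J k)], which pays for a step of
    cost [e * 2^-1 ^+ k]. *)
Lemma toll_step e J n t t' k : 0 <= e -> t <= t' ->
  (passed (J k) t < passed (J k) t')%N ->
  toll e J n t + e * 2^-1 ^+ k <= toll e J (n + k.+1) t'.
Proof.
move=> e0 tt' kk.
have w0 i : 0 <= e * 2^-1 ^+ i by rewrite mulr_ge0// exprn_ge0.
have kn : (k < n + k.+1)%N by rewrite addnS ltnS leq_addl.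
apply: le_trans (_ : toll e J (n + k.+1) t + e * 2^-1 ^+ k <= _).
  by rewrite lerD2r le_toll// leq_addr.
rewrite /toll (bigD1 (Ordinal kn)) //= [leRHS](bigD1 (Ordinal kn)) //= addrAC.
apply: lerD; last by apply: ler_sum => i _; rewrite ler_wpM2l// ler_nat le_passed.
by rewrite -[X in _ + X]mulr1 -mulrDr ler_wpM2l// natr1 ler_nat.
Qed.

Lemma toll_le e J n t : 0 <= e -> toll e J n t <= 4 * e.
Proof.
move=> e0; apply: (@le_trans _ _ (\sum_(k < n) 2 * e * 2^-1 ^+ k)).
  apply: ler_sum => k _; have -> : 2 * e * 2^-1 ^+ k = e * 2^-1 ^+ k * 2 by ring.
  by rewrite ler_wpM2l ?mulr_ge0 ?exprn_ge0// (ler_nat _ _ 2) passed_le2.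
suff -> : \sum_(k < n) 2 * e * 2^-1 ^+ k = 4 * e * (1 - 2^-1 ^+ n).
  by rewrite ler_piMr ?mulr_ge0// gerBl exprn_ge0.
elim: n => [|n IH]; first by rewrite big_ord0 expr0 subrr mulr0.
by rewrite big_ord_recr /= IH exprS; field.
Qed.

(** Let [b] be the supremum of the times that can be reached from [s] by a
    partition within budget [e * (t - s) + toll e J n t], and let [J k] contain
    [b].  If [J k] has points on the left of [b], then [b] is reached along a
    partition given by [J k]; otherwise [b] is the left end of [J k], and one
    short step to [b] is paid by [toll].  In the same way one goes beyond [b] if
    [b < t1].  The cover may have accumulating endpoints: the prices are
    summable and each end is crossed at most once. *)
Theorem null_on_cover T J h :
  (forall k, is_interval (J k)) -> (`[0, T] `<=` \bigcup_k J k)%classic ->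
  (forall k s t, J k s -> J k t -> 0 <= s -> s <= t -> t <= T -> null_on h s t) ->
  (forall e, 0 < e -> exists2 d, 0 < d & forall s t, 0 <= s -> s < t -> t <= T ->
     t - s < d -> h s t < e) ->
  forall s t, 0 <= s -> s <= t -> t <= T -> null_on h s t.
Proof.
move=> Jitv Jcov Jnull hsmall s t1 s0 st1 t1T e0 e00.
pose e := e0 / (t1 - s + 4).
have D0 : 0 < t1 - s + 4 by rewrite ltr_wpDl ?subr_ge0.
have e_gt0 : 0 < e by rewrite divr_gt0.
have e_ge0 := ltW e_gt0.
pose P t := exists x n, [/\ path <%R s x, last s x = t &
  psum h s x <= e * (t - s) + toll e J n t].
have along k t t' : P t -> J k t -> J k t' -> s <= t -> t < t' -> t' <= t1 -> P t'.
  move=> [x [n [sx xt xe]]] Jt Jt' st tt' t'1.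
  have [|y [ty yt' ye]] := Jnull k t t' Jt Jt' (le_trans s0 st) (ltW tt')
    (le_trans t'1 t1T) (e * (t' - t)); first by rewrite mulr_gt0// subr_gt0.
  exists (x ++ y), n; rewrite cat_path last_cat psum_cat xt sx ty yt'; split=> //.
  have := le_toll J e_ge0 (leqnn n) (ltW tt').
  move: xe ye; clear; lra.
have jump k t t' : P t -> s <= t -> t < t' -> t' <= t1 ->
    h t t' < e * 2^-1 ^+ k -> (passed (J k) t < passed (J k) t')%N -> P t'.
  move=> [x [n [sx xt xe]]] st tt' t'1 htt' kk.
  exists (x ++ [:: t']), (n + k.+1)%N.
  rewrite cat_path last_cat psum_cat xt /= sx tt' addr0; split=> //.
  have := toll_step n e_ge0 (ltW tt') kk.
  have : 0 <= e * (t' - t) by rewrite mulr_ge0// subr_ge0 ltW.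
  move: xe htt'; clear; lra.
have fee k : 0 < e * 2^-1 ^+ k by rewrite mulr_gt0// exprn_gt0.
pose S : set R := [set t : R | [/\ s <= t, t <= t1 & P t]]%classic.
have supS : has_sup S.
  split; last by exists t1 => t [].
  exists s; split=> //; exists [::], 0%N; split=> //=.
  by rewrite subrr mulr0 /toll big_ord0 addr0.
pose b := sup S.
have Sb t : S t -> t <= b by apply: ub_le_sup; case: supS.
have sb : s <= b by have [[t St] _] := supS; apply: le_trans (Sb _ St); case: St.
have bt1 : b <= t1 by apply: ge_sup => [|t []//]; case: supS.
have b0 := le_trans s0 sb; have bT := le_trans bt1 t1T.
have [k _ Jb] : (\bigcup_k J k)%classic b by apply: Jcov; rewrite /= in_itv /= b0.
have [d d0 hd] := hsmall _ (fee k).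
have near r : 0 < r -> ~ P b -> exists t, [/\ S t, b - r < t & t < b].
  move=> r0 nPb; have [t St tr] := sup_adherent r0 supS.
  exists t; split=> //; rewrite lt_neqAle Sb// andbT.
  by apply/eqP => tb; apply: nPb; rewrite -tb; case: St.
have Pb : P b.
  apply: contrapT => nPb.
  have [[x Jx xb]|nx] := pselect (exists2 x, J k x & x < b).
    have bx0 : 0 < b - x by rewrite subr_gt0.
    have [t [[st tt1 Pt] xt tb]] := near _ bx0 nPb.
    rewrite opprB addrC subrK in xt.
    have Jt : J k t by apply: Jitv Jx Jb _ _; rewrite (ltW xt) (ltW tb).
    exact/nPb/(along k t b).
  have [t [[st tt1 Pt] dt tb]] := near _ d0 nPb.
  have tbd : b - t < d by rewrite ltrBlDl -ltrBlDr.
  have kk : (passed (J k) t < passed (J k) b)%N.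
    apply: (passed_min Jb tb) => x Jx; rewrite leNgt; apply/negP => xb.
    by apply: nx; exists x.
  exact: (nPb (jump k t b Pt st tb bt1 (hd _ _ (le_trans s0 st) tb bT tbd) kk)).
have bE : b = t1.
  apply/eqP; rewrite eq_le bt1 /= leNgt; apply/negP => bt.
  suff [t bt' [tt1 Pt]] : exists2 t, b < t & t <= t1 /\ P t.
    have : t <= b by apply: Sb; split=> //; exact: le_trans (ltW bt').
    by rewrite leNgt bt'.
  have [[x Jx xb]|nx] := pselect (exists2 x, J k x & b < x).
    exists (Num.min x t1); first by rewrite lt_min xb.
    have mt : Num.min x t1 <= t1 by rewrite ge_min lexx orbT.
    have Jt : J k (Num.min x t1).
      by apply: Jitv Jb Jx _ _; rewrite le_min (ltW xb) bt1 ge_min lexx.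
    by split=> //; apply: (along k b) => //; rewrite lt_min xb.
  pose t := Num.min t1 (b + d / 2).
  have bt' : b < t by rewrite lt_min bt ltrDl divr_gt0.
  have tt1 : t <= t1 by rewrite ge_min lexx.
  have tbd : t - b < d.
    have : t <= b + d / 2 by rewrite ge_min lexx orbT.
    clear -d0; lra.
  have kk : (passed (J k) b < passed (J k) t)%N.
    apply: (passed_max Jb bt') => x Jx; rewrite leNgt; apply/negP => xb.
    by apply: nx; exists x.
  exists t => //; split=> //.
  exact: jump Pb sb bt' tt1 (hd _ _ b0 bt' (le_trans tt1 t1T) tbd) kk.
have [x [n [sx xb xe]]] := Pb.
exists x; split=> //; first by rewrite xb.
apply: le_trans xe _; rewrite bE.
have e0E : e0 = e * (t1 - s) + 4 * e by rewrite [4 * e]mulrC -mulrDr divfK// gt_eqF.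
by rewrite e0E lerD2l toll_le.
Qed.

End countable_cover.

(** * Coefficients of the equation *)

Section coefficients.
Context {R : realType}.
Implicit Types (f df ddf g dg : R -> R) (K M T p A C : R) (s t u x : R).

Lemma C11_le K K' f df : K <= K' -> C11 K f df -> C11 K' f df.
Proof.
move=> KK' [dfE fK dfK dfL]; split=> [//|x|x|x y].
- exact: le_trans KK'.
- exact: le_trans KK'.
- by apply: le_trans (dfL x y) _; rewrite ler_wpM2r.
Qed.

Lemma C11_of_bounds K f df ddf : (forall x, is_derive x 1 f (df x)) ->
  (forall x, is_derive x 1 df (ddf x)) -> (forall x, `|f x| <= K) ->
  (forall x, `|df x| <= K) -> (forall x, `|ddf x| <= K) -> C11 K f df.
Proof.
move=> dfE ddfE fK dfK ddfK; split=> // x y.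
have [r [_ _ ->]] := MVT_line y x ddfE.
by rewrite normrM ler_wpM2r.
Qed.

Lemma C11_scale K M f df c : C11 K f df -> `|c| <= M ->
  C11 (K * M) (fun x => f x * c) (fun x => df x * c).
Proof.
move=> Hf cM; have K0 := C11_ge0 Hf; have [dfE fK dfK dfL] := Hf.
split=> [x|x|x|x y]; rewrite -?mulrBl ?normrM.
- have := dfE x => ?.
  have h : is_derive x 1 (f * cst c) (df x * c).
    by apply: is_derive_eq; rewrite /GRing.scale /= mulr0 add0r mulrC.
  exact: h.
- exact: ler_pM.
- exact: ler_pM.
- rewrite -mulrA [M * _]mulrC mulrA; exact: ler_pM.
Qed.

Lemma C11_sum n K (f df : 'I_n -> R -> R) : (forall i, C11 K (f i) (df i)) ->
  C11 (n%:R * K) (fun x => \sum_(i < n) f i x) (fun x => \sum_(i < n) df i x).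
Proof.
move=> Hf.
have bound (h : 'I_n -> R) k : (forall i, `|h i| <= k) ->
    `|\sum_(i < n) h i| <= n%:R * k.
  move=> hk; apply: le_trans (ler_norm_sum _ _ _) _.
  apply: le_trans (ler_sum _ (fun i _ => hk i)) _.
  by rewrite sumr_const card_ord mulr_natl.
split=> [x|x|x|x y].
- have h : is_derive x 1 (\sum_(i < n) f i) (\sum_(i < n) df i x).
    by apply: is_derive_sum => i; case: (Hf i).
  by rewrite fct_sumE in h.
- by apply: bound => i; case: (Hf i).
- by apply: bound => i; case: (Hf i).
- by rewrite -sumrB -mulrA; apply: bound => i; case: (Hf i).
Qed.

Lemma C11_mul K f df g dg : C11 K f df -> C11 K g dg ->
  C11 (4 * K ^+ 2) (fun x => f x * g x) (fun x => f x * dg x + g x * df x).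
Proof.
move=> Hf Hg; have K0 := C11_ge0 Hf.
have K2 : 0 <= K ^+ 2 by rewrite exprn_ge0.
have KK x y : `|x| <= K -> `|y| <= K -> `|x * y| <= K ^+ 2.
  by move=> xK yK; rewrite normrM expr2; exact: ler_pM.
split=> [x|x|x|x y].
- have := C11_derive Hf x => ?; have := C11_derive Hg x => ?.
  have h : is_derive x 1 (f * g) (f x * dg x + g x * df x) by exact: is_deriveM.
  exact: h.
- have := KK _ _ (C11_bound Hf x) (C11_bound Hg x); clear -K2; lra.
- apply: le_trans (ler_normD _ _) _.
  have := KK _ _ (C11_bound Hf x) (C11_dbound Hg x).
  have := KK _ _ (C11_bound Hg x) (C11_dbound Hf x); clear -K2; lra.
- have -> : f x * dg x + g x * df x - (f y * dg y + g y * df y) =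
      (f x - f y) * dg x + f y * (dg x - dg y) + ((g x - g y) * df x + g y * (df x - df y)).
    by ring.
  have KL a b : `|a| <= K * `|x - y| -> `|b| <= K -> `|a * b| <= K ^+ 2 * `|x - y|.
    move=> aK bK; rewrite normrM expr2 mulrAC; exact: ler_pM.
  have h1 := KL _ _ (C11_lip x y Hf) (C11_dbound Hg x).
  have h2 := KL _ _ (C11_dlip Hg x y) (C11_bound Hf y).
  have h3 := KL _ _ (C11_lip x y Hg) (C11_dbound Hf x).
  have h4 := KL _ _ (C11_dlip Hf x y) (C11_bound Hg y).
  rewrite [f y * _]mulrC [g y * _]mulrC.
  apply: le_trans (ler_normD _ _) _.
  have := ler_normD ((f x - f y) * dg x) ((dg x - dg y) * f y).
  have := ler_normD ((g x - g y) * df x) ((df x - df y) * g y).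
  clear -h1 h2 h3 h4; lra.
Qed.

Variable N : nat.
Implicit Types (F : R -> 'rV[R]_N).

Definition dcoef F k (i : 'I_N) x : R := (F^`(k))%classic x 0 i.

Lemma is_derive_dcoef F k i x : C3b F -> (k < 3)%N ->
  is_derive x 1 (dcoef F k i) (dcoef F k.+1 i x).
Proof.
move=> [Fd _] k3; have Fdx := Fd k k3 x; split.
  by have := (derivable_mxP _ _ _).1 Fdx 0 i.
rewrite /dcoef derive1nS derive1E (derive_mx Fdx) mxE; reflexivity.
Qed.

Lemma dcoef0E F i : Defs.coef1 F i = dcoef F 0 i.
Proof. by []. Qed.

Lemma coef2E F i j x : C3b F -> Defs.coef2 F i j x = dcoef F 1 i x * dcoef F 0 j x.
Proof.
move=> HF; rewrite /Defs.coef2 dcoef0E derive1E.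
by have [_ ->] := is_derive_dcoef i x HF (isT : (0 < 3)%N).
Qed.

Lemma norm_entry_le m n (X : 'M[R]_(m, n)) i j : `|X i j| <= `|X|.
Proof.
rewrite [leRHS]/Num.Def.normr/= mx_normrE.
exact: (le_bigmax _ _ (i, j)).
Qed.

Lemma dcoef_bounded F : C3b F -> exists K, 
  forall k i x, (k <= 3)%N -> `|dcoef F k i x| <= K.
Proof.
move=> [_ Fb].
have [K HK] : exists K : nat -> R, forall k, (k <= 3)%N -> forall x, `|(F^`(k))%classic x| <= K k.
  have /choice [K HK] : forall k, exists M : R, (k <= 3)%N -> forall x, `|(F^`(k))%classic x| <= M.
    move=> k; have [k3|] := boolP (k <= 3)%N; last by exists 0.
    have [M [_ HM]] := Fb k k3.
    by exists (M + 1) => _ x; apply: HM; rewrite ?ltrDl.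
  by exists K => k k3 x; apply: HK.
exists (\sum_(k < 4) `|K k|) => k i x k3.
apply: le_trans (norm_entry_le _ _ _) _; apply: le_trans (HK k k3 x) _.
rewrite (bigD1 (Ordinal (k3 : (k < 4)%N)))//=.
by apply: le_trans (ler_norm _) _; rewrite lerDl sumr_ge0.
Qed.
End coefficients.

(** * A common control, and the driver of the equation *)

Section controls.
Context {R : realType}.
Implicit Types (T p e s t u : R) (om w : R -> R -> R) (m : R -> R).

Record control T om : Prop := {
  ctl_ge0 : forall s t, 0 <= s -> s <= t -> t <= T -> 0 <= om s t;
  ctl_super : superadditive T om;
  ctl_small : forall e, 0 < e -> exists2 d, 0 < d &
    forall s t, 0 <= s -> s <= t -> t <= T -> t - s < d -> om s t <= e }.

Lemma control_add T om om' : control T om -> control T om' ->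
  control T (fun s t => om s t + om' s t).
Proof.
move=> c c'; split=> [s t s0 st tT|s u t s0 su ut tT|e e0].
- by rewrite addr_ge0 ?(ctl_ge0 c) ?(ctl_ge0 c').
- have := ctl_super c s0 su ut tT; have := ctl_super c' s0 su ut tT; clear; lra.
- have e20 : 0 < e / 2 by rewrite divr_gt0.
  have [d d0 h] := ctl_small c e20; have [d' d'0 h'] := ctl_small c' e20.
  exists (Num.min d d') => [|s t s0 st tT]; first by rewrite lt_min d0.
  rewrite lt_min => /andP[td td'].
  have := h _ _ s0 st tT td; have := h' _ _ s0 st tT td'; clear; lra.
Qed.

Lemma control_variation (E : normedModType R) T q (g : R -> R -> E) : 0 < q ->
  V2 q `[0, T]%classic g -> control T (variation_control q g).
Proof.
move=> q0 Vg; split.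
- exact: variation_control_ge0.
- exact: variation_control_superadditive.
- exact: variation_control_small.
Qed.

Lemma control_increment T m :
  (forall s t, 0 <= s -> s <= t -> t <= T -> m s <= m t) ->
  V1 1 `[0, T]%classic m -> control T (fun s t => m t - m s).
Proof.
move=> mnd Vm; split=> [s t s0 st tT|s u t _ _ _ _|e e0].
- by rewrite subr_ge0 mnd.
- by clear; lra.
- have [d d0 h] := variation_control_small ltr01 Vm e0.
  exists d => // s t s0 + tT tsd; rewrite le_eqVlt => /predU1P[->|st].
    by rewrite subrr ltW.
  apply: le_trans (h _ _ s0 (ltW st) tT tsd).
  apply: le_trans (norm_le_variation_control ltr01 Vm s0 st tT).
  by rewrite powRr1// ler_norm.
Qed.

(** Dividing by [om 0 T + 1] makes the control at most 1. *)
Lemma control_root T p om : 0 <= T -> 0 < p -> control T om ->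
  exists A w, [/\ 1 <= A, root_control T p w &
    forall s t, 0 <= s -> s <= t -> t <= T -> om s t = A * w s t `^ p].
Proof.
move=> T0 p0 c; pose A := om 0 T + 1.
have A1 : 1 <= A by rewrite lerDr (ctl_ge0 c).
have A0 : 0 < A by apply: lt_le_trans A1.
pose w s t := (om s t / A) `^ p^-1.
have omA s t : 0 <= s -> s <= t -> t <= T -> om s t / A <= 1.
  move=> s0 st tT; have sT := le_trans st tT.
  rewrite ler_pdivrMr// mul1r; have t0 := le_trans s0 st.
  have := ctl_super c (lexx _) s0 st tT; have := ctl_super c (lexx _) t0 tT (lexx _).
  have := ctl_ge0 c (lexx _) s0 sT; have := ctl_ge0 c t0 tT (lexx _).
  rewrite /A; clear; lra.
have om0 s t : 0 <= s -> s <= t -> t <= T -> 0 <= om s t / A.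
  by move=> *; rewrite divr_ge0 ?(ctl_ge0 c)// ltW.
have wp s t : 0 <= s -> s <= t -> t <= T -> w s t `^ p = om s t / A.
  by move=> *; rewrite /w -powRrM mulVf ?gt_eqF// powRr1// om0.
exists A, w; split=> //; last first.
  by move=> s t s0 st tT; rewrite wp// mulrC divfK// gt_eqF.
split=> [s t _ _ _|s t s0 st tT|s u t s0 su ut tT|e e0].
- exact: powR_ge0.
- rewrite /w; have := omA s t s0 st tT; rewrite le_eqVlt => /predU1P[->|lt1].
    by rewrite powR1.
  by apply/ltW/powR_lt1; rewrite ?invr_gt0 ?om0.
- have u0 := le_trans s0 su; have uT := le_trans ut tT; have st := le_trans su ut.
  rewrite !wp// -mulrDl ler_wpM2r ?invr_ge0 ?(ltW A0)//.
  exact: (ctl_super c).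
- have ep : 0 < e `^ p by rewrite powR_gt0.
  have ep2 : 0 < e `^ p / 2 by rewrite divr_gt0.
  have [d d0 h] := ctl_small c ep2; exists d => // s t s0 st tT tsd.
  rewrite ltNge; apply/negP => ew.
  have : e `^ p <= w s t `^ p.
    by apply: ge0_ler_powR; rewrite ?nnegrE ?powR_ge0 ?(ltW p0) ?(ltW e0).
  rewrite wp// ler_pdivlMr//; have := h _ _ s0 st tT tsd.
  have : e `^ p * 1 <= e `^ p * A by rewrite ler_pM2l.
  move: ep; clear; lra.
Qed.

Lemma le_root_power p q (n : nat) A v x : 1 <= q -> 1 <= A -> 0 <= v -> 0 <= x ->
  p = n%:R * q -> x `^ q <= A * v `^ p -> x <= A * v ^+ n.
Proof.
move=> q1 A1 v0 x0 pE xA; have A0 : 0 <= A by apply: le_trans A1.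
have q0 : 0 < q by apply: lt_le_trans q1.
apply: (ler_powR_inv q0) => //; first by rewrite mulr_ge0 ?exprn_ge0.
apply: le_trans xA _; rewrite powRM ?exprn_ge0//.
rewrite -powR_mulrn// -powRrM -pE ler_wpM2r ?powR_ge0//.
exact: le1r_powR.
Qed.

End controls.

Section driver.
Context {R : realType} {N : nat}.
Implicit Types (T p A C : R) (s t u x : R) (w : R -> R -> R).
Implicit Types (F : R -> 'rV[R]_N).

(** Chen's relation is a hypothesis for [s < u < t] only and says nothing about
    values on the diagonal.  Setting these to 0 makes it hold for
    [s <= u <= t]. *)
Definition offdiag (g : R -> R -> R) s t : R := if s < t then g s t else 0.

Definition field1 F (X1 : R -> R -> 'rV[R]_N) k s t x : R :=
  \sum_(i < N) dcoef F k i x * offdiag (fun s t => X1 s t 0 i) s t.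

Definition field2 F (X2 : R -> R -> 'M[R]_N) s t x : R :=
  \sum_(i < N) \sum_(j < N)
    dcoef F 1 i x * dcoef F 0 j x * offdiag (fun s t => X2 s t j i) s t.

Definition dfield2 F (X2 : R -> R -> 'M[R]_N) s t x : R :=
  \sum_(i < N) \sum_(j < N)
    (dcoef F 1 i x * dcoef F 1 j x + dcoef F 0 j x * dcoef F 2 i x) *
    offdiag (fun s t => X2 s t j i) s t.

Lemma offdiag_le (g : R -> R -> R) M s t : 0 <= M -> (s < t -> `|g s t| <= M) ->
  `|offdiag g s t| <= M.
Proof. by move=> M0 gM; rewrite /offdiag; case: ifP => [/gM//|_]; rewrite normr0. Qed.

Lemma rough_driver_fields T p w A F
    (X1 : R -> R -> 'rV[R]_N) (X2 : R -> R -> 'M[R]_N) : 0 < p -> p < 3 -> 0 <= A ->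
  root_control T p w -> C3b F -> rough_path T p X1 X2 ->
  (forall s t, 0 <= s -> s < t -> t <= T -> `|X1 s t| <= A * w s t) ->
  (forall s t, 0 <= s -> s < t -> t <= T -> `|X2 s t| <= A * w s t ^+ 2) ->
  exists C0, forall C, C0 <= C ->
    rough_driver T p w C (field1 F X1 0) (field1 F X1 1) (field1 F X1 2)
      (field2 F X2) (dfield2 F X2).
Proof.
move=> p0 p3 A0 rc HF [_ _ chen1 chen2] X1A X2A.
have [K0 HK0] := dcoef_bounded HF; pose K := `|K0|.
have K_ge0 : 0 <= K := normr_ge0 _.
have HK k i x : (k <= 3)%N -> `|dcoef F k i x| <= K.
  by move=> k3; apply: le_trans (HK0 k i x k3) (ler_norm _).
have C11d k i : (k < 2)%N -> C11 K (dcoef F k i) (dcoef F k.+1 i).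
  move=> k2; have k3 : (k < 3)%N := leq_trans k2 (leqnSn 2).
  exact: (@C11_of_bounds R K _ _ (dcoef F k.+2 i)
    (fun x => is_derive_dcoef i x HF k3)
    (fun x => is_derive_dcoef i x HF (k2 : (k.+1 < 3)%N))
    (fun x => HK k i x (ltnW k3)) (fun x => HK k.+1 i x k3)
    (fun x => HK k.+2 i x (k2 : (k.+2 <= 3)%N))).
exists (N%:R * (K * A) + N%:R * (N%:R * (4 * K ^+ 2 * A))) => C CC.
have NKA : 0 <= N%:R * (K * A) by rewrite !mulr_ge0.
have NKKA : 0 <= N%:R * (N%:R * (4 * K ^+ 2 * A)) by rewrite !mulr_ge0 ?exprn_ge0.
have C1 : N%:R * (K * A) <= C by apply: le_trans CC; rewrite lerDl.
have C2 : N%:R * (N%:R * (4 * K ^+ 2 * A)) <= C by apply: le_trans CC; rewrite lerDr.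
have C11f k s t : (k < 2)%N -> 0 <= s -> s <= t -> t <= T ->
    C11 (C * w s t) (field1 F X1 k s t) (field1 F X1 k.+1 s t).
  move=> k2 s0 st tT; have w0 := rc_ge0 rc s0 st tT.
  apply: (@C11_le _ (N%:R * (K * (A * w s t)))); first by rewrite !mulrA ler_wpM2r// -mulrA.
  apply: C11_sum => i; apply: C11_scale; first exact: C11d.
  apply: offdiag_le => [|lst]; first by rewrite mulr_ge0.
  by apply: le_trans (norm_entry_le _ _ _) _; exact: X1A.
split=> //.
- exact: le_trans C1.
- by move=> *; apply: C11f.
- by move=> *; apply: C11f.
- move=> s t s0 st tT; have w0 := rc_ge0 rc s0 st tT.
  apply: (@C11_le _ (N%:R * (N%:R * (4 * K ^+ 2 * (A * w s t ^+ 2))))).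
    have -> : N%:R * (N%:R * (4 * K ^+ 2 * (A * w s t ^+ 2))) =
      N%:R * (N%:R * (4 * K ^+ 2 * A)) * w s t ^+ 2 by ring.
    by rewrite ler_wpM2r// exprn_ge0.
  apply: C11_sum => i; apply: C11_sum => j; apply: C11_scale.
    by apply: C11_mul; apply: C11d.
  apply: offdiag_le => [|lst]; first by rewrite mulr_ge0// exprn_ge0.
  by apply: le_trans (norm_entry_le _ _ _) _; exact: X2A.
- move=> s u t x s0 su ut tT; rewrite /field1 -big_split /=; apply: eq_bigr => i _.
  rewrite -mulrDr; congr (_ * _); rewrite /offdiag.
  move: su ut; rewrite !le_eqVlt => /predU1P[->|su] /predU1P[utE|ut].
  + by rewrite utE ltxx addr0.
  + by rewrite ltxx ut add0r.
  + by rewrite -utE su ltxx addr0.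
  + rewrite su ut (lt_trans su ut).
    have /matrixP/(_ 0 i) := chen1 _ _ _ s0 su ut tT.
    by rewrite /delta2 !mxE => /eqP; rewrite -addrA -opprD subr_eq0 => /eqP.
- move=> s u t x s0 su ut tT; rewrite /field2 /field1.
  rewrite mulr_suml -!big_split /=; apply: eq_bigr => i _.
  rewrite mulr_sumr -!big_split /=; apply: eq_bigr => j _.
  suff -> : offdiag (fun s t => X2 s t j i) s t =
      offdiag (fun s t => X2 s t j i) s u + offdiag (fun s t => X2 s t j i) u t +
      offdiag (fun s t => X1 s t 0 j) s u * offdiag (fun s t => X1 s t 0 i) u t.
    by ring.
  rewrite /offdiag; move: su ut; rewrite !le_eqVlt => /predU1P[->|su] /predU1P[utE|ut].
  + by rewrite utE ltxx mul0r !addr0.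
  + by rewrite ltxx ut add0r mul0r addr0.
  + by rewrite -utE su ltxx mulr0 !addr0.
  + rewrite su ut (lt_trans su ut).
    have := chen2 _ _ _ s0 su ut tT j i; rewrite /delta2 !mxE => <-; ring.
Qed.

End driver.

(** * Solutions of the reflected equation *)

Section solutions.
Context {R : realType}.
Implicit Types (T p q C e s t u x : R) (w : R -> R -> R) (y m : R -> R).

Lemma variation_small (E : normedModType R) T q (g : R -> R -> E) : 0 < q ->
  V2 q `[0, T]%classic g -> forall e, 0 < e -> exists2 d, 0 < d &
    forall s t, 0 <= s -> s < t -> t <= T -> t - s < d -> `|g s t| < e.
Proof.
move=> q0 Vg e e0; have eq0 : 0 < e `^ q by rewrite powR_gt0.
have eq20 : 0 < e `^ q / 2 by rewrite divr_gt0.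
have [d d0 h] := variation_control_small q0 Vg eq20.
exists d => // s t s0 st tT tsd; rewrite ltNge; apply/negP => eg.
have : e `^ q <= `|g s t| `^ q.
  by apply: ge0_ler_powR; rewrite ?nnegrE ?(ltW q0) ?(ltW e0).
have := norm_le_variation_control q0 Vg s0 st tT.
have := h _ _ s0 (ltW st) tT tsd; move: eq0; clear; lra.
Qed.

Lemma variation_path_bounded (T q : R) y : 0 < q -> V1 q `[0, T]%classic y ->
  exists M, forall s t, 0 <= s -> s <= t -> t <= T -> `|y t - y s| <= M.
Proof.
move=> q0 Vy; have [M MU] := pvar_sums_bounded q0 Vy.1.
exists (`|M| `^ q^-1) => s t s0 + tT; rewrite le_eqVlt => /predU1P[->|st].
  by rewrite subrr normr0 powR_ge0.
apply: (ler_powR_inv q0); rewrite ?powR_ge0//.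
rewrite -powRrM mulVf ?gt_eqF// powRr1//; apply: le_trans (ler_norm _).
apply: MU.
have : pvar_sums q `[s, t]%classic (delta1 y)
    (psum (fun u v => `|delta1 y u v| `^ q) s [:: t]).
  by apply: pvar_sums_path => //=; rewrite st.
rewrite /= addr0; apply: pvar_sums_sub => u; rewrite /= !in_itv /= => /andP[su ut].
by rewrite (le_trans s0)//= (le_trans ut).
Qed.

(** The integrand [1_{y = 0}] restricted to [[0, t]] is the same function as its
    restriction to [[0, s]], so the two integrals are equal. *)
Lemma reflection_flat T a p (N : nat) (F : R -> 'rV[R]_N)
    (X1 : R -> R -> 'rV[R]_N) (X2 : R -> R -> 'M[R]_N) y m :
  reflected_solution T a p F X1 X2 y m ->
  forall s t, 0 <= s -> s <= t -> t <= T ->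
    (forall u, s < u -> u <= t -> 0 < y u) -> m t = m s.
Proof.
move=> sol s t s0 st tT ypos; have [mu _ mE] := rsol_refl sol.
have t0 := le_trans s0 st; have sT := le_trans st tT.
have := mE t; rewrite t0 tT => /(_ isT); have := mE s; rewrite s0 sT => /(_ isT).
rewrite integral_mkcond => ms; rewrite integral_mkcond => mt.
apply: EFin_inj; rewrite ms mt; congr (integral _ _ _); apply/funext => u.
rewrite /patch; case: ifPn => ut; case: ifPn => us //.
- have /andP[u0 ut'] : 0 <= u <= t by move: ut; rewrite inE /= in_itv.
  have su : s < u.
    by rewrite ltNge; apply: contra us => us; rewrite inE /= in_itv /= u0.
  by rewrite indicE memNset//= => yu; have := ypos u su ut'; rewrite yu ltxx.
- have /andP[u0 us'] : 0 <= u <= s by move: us; rewrite inE /= in_itv.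
  by case/negP: ut; rewrite inE /= in_itv /= u0 (le_trans us').
Qed.

Lemma reflection_init T a p (N : nat) (F : R -> 'rV[R]_N)
    (X1 : R -> R -> 'rV[R]_N) (X2 : R -> R -> 'M[R]_N) y m :
  0 <= T -> 0 < a -> reflected_solution T a p F X1 X2 y m -> m 0 = 0.
Proof.
move=> T0 a0 sol; have [mu _ mE] := rsol_refl sol.
have := mE 0; rewrite lexx T0 => /(_ isT) m0; apply: EFin_inj; rewrite m0.
apply: integral0_eq => u; rewrite /= in_itv /= -eq_le => /eqP <-.
rewrite indicE memNset//= => y0; move: a0.
by rewrite -(rsol_init sol) y0 ltxx.
Qed.

(** For [s < t] the remainder is the [yn] of the equation.  It is small near the
    diagonal because all the other terms are, and its sums of powers [p/3] are
    bounded on every member of the cover, so [null_on_pvar] applies there and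
    [null_on_cover] extends the conclusion to [[0, T]]. *)
Lemma davie_of_reflected T a p w A (N : nat) (F : R -> 'rV[R]_N)
    (X1 : R -> R -> 'rV[R]_N) (X2 : R -> R -> 'M[R]_N) C0 y m :
  0 < p -> p < 3 -> root_control T p w -> C3b F ->
  (forall C, C0 <= C -> rough_driver T p w C (field1 F X1 0) (field1 F X1 1)
      (field1 F X1 2) (field2 F X2) (dfield2 F X2)) ->
  (forall s t, 0 <= s -> s <= t -> t <= T -> m t - m s <= A * w s t ^+ 2) ->
  reflected_solution T a p F X1 X2 y m ->
  exists C1, forall C, C1 <= C ->
    davie_solution T w C (field1 F X1 0) (field2 F X2) y m.
Proof.
move=> p0 p3 rc HF rdC mA sol.
have [M yM] := variation_path_bounded p0 (rsol_yV sol).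
have mnd := rsol_m_nd sol.
pose g := remainder (field1 F X1 0) (field2 F X2) y m.
suff gnull : forall s t, 0 <= s -> s <= t -> t <= T -> null_on (fun u v => `|g u v|) s t.
  exists (`|M| + `|A|) => C CC; split=> // s t s0 st tT.
    apply: le_trans (yM s t s0 st tT) _; apply: le_trans CC.
    by apply: le_trans (ler_norm _) _; rewrite lerDl.
  apply: le_trans (mA s t s0 st tT) _; rewrite ler_wpM2r ?exprn_ge0 ?(rc_ge0 rc)//.
  by apply: le_trans CC; apply: le_trans (ler_norm _) _; rewrite lerDr.
have [yn [J [Jitv JI Jcov JV]] yeq] := rsol_eq sol.
have gE s t : 0 <= s -> s < t -> t <= T -> g s t = yn s t.
  move=> s0 st tT; have := yeq s t s0 (ltW st) tT.
  rewrite /g /remainder /field1 /field2 /offdiag st /delta1 => ->.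
  have -> : \sum_(i < N) \sum_(j < N) Defs.coef2 F i j (y s) * X2 s t j i =
      \sum_(i < N) \sum_(j < N) dcoef F 1 i (y s) * dcoef F 0 j (y s) * X2 s t j i.
    by apply: eq_bigr => i _; apply: eq_bigr => j _; rewrite coef2E.
  have -> : \sum_(i < N) Defs.coef1 F i (y s) * X1 s t 0 i =
      \sum_(i < N) dcoef F 0 i (y s) * X1 s t 0 i by [].
  by ring.
have q0 : 0 < p / 3 by rewrite divr_gt0.
have q1 : p / 3 < 1 by rewrite ltr_pdivrMr// mul1r.
have small e : 0 < e -> exists2 d, 0 < d & forall s t, 0 <= s -> s < t -> t <= T ->
    t - s < d -> `|g s t| < e.
  move=> e0; have e20 : 0 < e / 2 by rewrite divr_gt0.
  have [d d0 yd] := variation_small p0 (rsol_yV sol) e20.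
  pose C := `|C0| + `|A|.
  have rd : rough_driver T p w C (field1 F X1 0) (field1 F X1 1)
      (field1 F X1 2) (field2 F X2) (dfield2 F X2).
    by apply: rdC; apply: le_trans (ler_norm _) _; rewrite lerDl.
  have C_ge0 := rd_C0 rd.
  have C30 : 0 < 3 * C + 1 by rewrite ltr_wpDl ?mulr_ge0.
  have [d' d'0 wd] := rc_small rc (divr_gt0 e20 C30).
  exists (Num.min d d') => [|s t s0 st tT]; first by rewrite lt_min d0.
  rewrite lt_min => /andP[td td']; have st' := ltW st.
  have := yd _ _ s0 st tT td; have := wd _ _ s0 st' tT td'.
  rewrite ltr_pdivlMr// => we ye.
  have w0 := rc_ge0 rc s0 st' tT; have w1 := rc_le1 rc s0 st' tT.
  have ww : w s t ^+ 2 <= w s t by rewrite expr2 ler_piMl.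
  have aC := C11_bound (rd_a rd s0 st' tT) (y s).
  have bC := C11_bound (rd_b rd s0 st' tT) (y s).
  have mC : m t - m s <= C * w s t ^+ 2.
    apply: le_trans (mA s t s0 st' tT) _; rewrite ler_wpM2r ?exprn_ge0//.
    by apply: le_trans (ler_norm _) _; rewrite lerDr.
  have Cww := ler_wpM2l C_ge0 ww.
  have tri : `|g s t| <= `|y t - y s| + `|field1 F X1 0 s t (y s)|
      + `|field2 F X2 s t (y s)| + `|m t - m s|.
    do 2 (apply: le_trans (ler_normB _ _) _; rewrite lerD2r).
    exact: ler_normB.
  rewrite [`|m t - m s|]ger0_norm ?subr_ge0 ?mnd// in tri.
  move: ye; rewrite /delta1 => ye.
  clear -we ye aC bC mC Cww tri w0; lra.
apply: (null_on_cover Jitv Jcov _ small) => k s t Js Jt s0 st tT.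
have [V HV] := pvar_sums_bounded q0 (JV k).1.
apply: (@null_on_pvar R _ (p / 3) V) => //.
- move=> x sx xt; apply: HV; exists s, t, x; split=> //; last first.
    rewrite pvar_sumE; apply/eqP; rewrite eq_le; apply/andP.
    have eqn u v : s <= u -> u < v -> v <= t -> `|g u v| `^ (p / 3) = `|yn u v| `^ (p / 3).
      by move=> su uv vt; rewrite gE//; [exact: le_trans su|exact: le_trans tT].
    have xt' : last s x <= t by rewrite xt.
    by split; apply: (le_psum _ sx (lexx _) xt') => // u v su uv vt; rewrite eqn.
  by split=> //; apply/eqP.
- move=> e e0; have [d d0 gd] := small e e0; exists d => // u v su uv vt.
  by apply: gd => //; [exact: le_trans su|exact: le_trans tT].
Qed.

End solutions.

Unset Implicit Arguments.
Theorem theorem5 (R : realType) (T a p : R) (N : nat) (f : R -> 'rV[R]_N)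
    (X1 : R -> R -> 'rV[R]_N) (X2 : R -> R -> 'M[R]_N) :
  0 < T -> 0 < a -> (1 <= N)%N -> 2 <= p -> p < 3 ->
  C3b f -> rough_path T p X1 X2 ->
  forall y m y' m' : R -> R,
    reflected_solution T a p f X1 X2 y m ->
    reflected_solution T a p f X1 X2 y' m' ->
    forall t : R, 0 <= t <= T -> y t = y' t /\ m t = m' t.
Proof.
move=> T0 a0 _ p2 p3 Hf HX y m y' m' sol sol'.
have [VX1 VX2 _ _] := HX.
have p0 : 0 < p by apply: lt_le_trans p2.
have p20 : 0 < p / 2 by rewrite divr_gt0.
have p21 : 1 <= p / 2 by rewrite ler_pdivlMr// mul1r.
have p1 : 1 <= p by apply: le_trans p2; rewrite ler1n.
have c1 := control_variation p0 VX1.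
have c2 := control_variation p20 VX2.
have c3 := control_increment (rsol_m_nd sol) (rsol_mV sol).
have c4 := control_increment (rsol_m_nd sol') (rsol_mV sol').
have [A [w [A1 rc omE]]] :=
  control_root (ltW T0) p0 (control_add (control_add (control_add c1 c2) c3) c4).
have A0 : 0 <= A by apply: le_trans A1.
have parts s t : 0 <= s -> s <= t -> t <= T ->
    [/\ variation_control p X1 s t <= A * w s t `^ p,
        variation_control (p / 2) X2 s t <= A * w s t `^ p,
        m t - m s <= A * w s t `^ p & m' t - m' s <= A * w s t `^ p].
  move=> s0 st tT; rewrite -omE//.
  have h1 := ctl_ge0 c1 s0 st tT; have h2 := ctl_ge0 c2 s0 st tT.
  have h3 := ctl_ge0 c3 s0 st tT; have h4 := ctl_ge0 c4 s0 st tT.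
  by clear -h1 h2 h3 h4; split; lra.
have wp2 s t : 0 <= s -> s <= t -> t <= T -> A * w s t `^ p <= A * w s t ^+ 2.
  move=> s0 st tT; rewrite ler_wpM2l//.
  have := rc_ge0 rc s0 st tT; rewrite le_eqVlt => /predU1P[<-|w0].
    by rewrite powR0 ?gt_eqF// expr0n.
  by rewrite -(powR_mulrn 2 (ltW w0)) ger_powR// w0 (rc_le1 rc).
have X1A s t : 0 <= s -> s < t -> t <= T -> `|X1 s t| <= A * w s t.
  move=> s0 st tT; have [h _ _ _] := parts s t s0 (ltW st) tT.
  rewrite -[w s t]expr1; apply: (@le_root_power R p p) => //.
  - exact: (rc_ge0 rc s0 (ltW st) tT).
  - by rewrite mul1r.
  - exact: le_trans (norm_le_variation_control p0 VX1 s0 st tT) h.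
have X2A s t : 0 <= s -> s < t -> t <= T -> `|X2 s t| <= A * w s t ^+ 2.
  move=> s0 st tT; have [_ h _ _] := parts s t s0 (ltW st) tT.
  apply: (@le_root_power R p (p / 2)) => //.
  - exact: (rc_ge0 rc s0 (ltW st) tT).
  - by rewrite mulrC divfK.
  - exact: le_trans (norm_le_variation_control p20 VX2 s0 st tT) h.
have [C0 rdC] := rough_driver_fields p0 p3 A0 rc Hf HX X1A X2A.
have mA s t : 0 <= s -> s <= t -> t <= T -> m t - m s <= A * w s t ^+ 2.
  by move=> s0 st tT; have [_ _ h _] := parts s t s0 st tT; apply: le_trans h (wp2 _ _ _ _ _).
have m'A s t : 0 <= s -> s <= t -> t <= T -> m' t - m' s <= A * w s t ^+ 2.
  by move=> s0 st tT; have [_ _ _ h] := parts s t s0 st tT; apply: le_trans h (wp2 _ _ _ _ _).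
have [C1 dsC] := davie_of_reflected p0 p3 rc Hf rdC mA sol.
have [C2 dsC'] := davie_of_reflected p0 p3 rc Hf rdC m'A sol'.
pose C := Num.max C0 (Num.max C1 C2).
have rd := rdC C (ltac:(by rewrite /C le_max lexx)).
have ds := dsC C (ltac:(by rewrite /C !le_max lexx orbT)).
have ds' := dsC' C (ltac:(by rewrite /C !le_max lexx !orbT)).
have y0 : y 0 = y' 0 by rewrite (rsol_init sol) (rsol_init sol').
have ypos s : 0 <= s -> s <= T -> 0 <= y s.
  by move=> s0 sT; apply: (rsol_y_ge0 sol); rewrite s0.
have y'pos s : 0 <= s -> s <= T -> 0 <= y' s.
  by move=> s0 sT; apply: (rsol_y_ge0 sol'); rewrite s0.
have yy' s : 0 <= s -> s <= T -> y s = y' s.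
  move=> s0 sT; apply/eqP; rewrite eq_le.
  rewrite (comparison rd ds ds' y0 y'pos (reflection_flat sol) s0 sT).
  exact: (comparison rd ds' ds (esym y0) ypos (reflection_flat sol') s0 sT).
have m00 : m 0 = m' 0.
  by rewrite (reflection_init (ltW T0) a0 sol) (reflection_init (ltW T0) a0 sol').
move=> t /andP[t0 tT]; split; first exact: yy'.
exact: (reflection_determined rd ds ds' yy' m00 t0 tT).
Qed.
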